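(* Let $F$ be a mixed graph with at least one directed edge such that $\theta(F)\in(1,\infty)$. Then \[\theta(F)=\min_{B=(U,D)\in\mathcal M_F\setminus\{K\}}\ \min_{\mathbf y\in\Delta_{r(B)}}\frac{1-\mathbf y^\intercal U\mathbf y}{\mathbf y^\intercal D\mathbf y},\] where $r(B)$ is the size of $B$ and the quotient is taken to be $\infty$ when $\mathbf y^\intercal D\mathbf y=0$. Moreover, if $B^*$ attains the outer minimum, then $g_{\theta(F)}(B^* )=1$.
   Context: Mixed graphs: finite vertex set, at most one edge on each pair of distinct vertices, each edge undirected or directed (tail $\to$ head). A head (tail) vertex is the head (tail) of some directed edge. $\alpha(G),\beta(G)$ are the numbers of undirected and directed edges divided by $\binom{v(G)}2$. $F\subseteq G$ means there is an injection $V(F)\to V(G)$ sending undirected edges of $F$ to edges of either type of $G$ and each directed edge $u\to v$ of $F$ to the directed edge $\phi(u)\to\phi(v)$ of $G$; $G$ is $F$-free if $F\not\subseteq G$. $\theta(F)$ is the maximum $\rho$ with $\limsup_n\max\{\alpha(G)+\rho\beta(G):G\ F\text{-free},\ v(G)=n\}\le1$ ($\theta(F)=\infty$ if $\max\beta(G)\to0$). $F$ is collapsible if no two head vertices are adjacent and no two tail vertices are adjacent. For collapsible $F$ with at least one directed edge, let $V_h,V_t$ be the sets of head and tail vertices and $V_0$ the rest; $F^\rhd$ is obtained by contracting $V_h$ to a single vertex $h$ and $V_t$ to a single vertex $t$: it has $F[V_0]$ on $V_0$, an undirected edge $wh$ (resp. $wt$) for $w\in V_0$ iff $w$ is adjacent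 in $F$ to a vertex of $V_h$ (resp. $V_t$), and the directed edge $t\to h$. $\chi(\cdot)$ is the chromatic number of the underlying undirected graph. A mixed adjacency matrix of size $r$ is a pair $A=(U,D)$ of $r\times r$ matrices with $U$ symmetric with entries in $\{0,1\}$, $D_{ij}\in\{0,2\}$ with $D_{ij}\ne0\Rightarrow D_{ji}=0$ (so $D_{ii}=0$), and for all $i,j$ at most one of $U_{ij},D_{ij}$ nonzero. For $\mathbf x\in\mathbb Z_{\ge0}^r$, the mixed graph $A[\![\mathbf x]\!]$ has vertex set $W_1\sqcup\dots\sqcup W_r$, $|W_i|=x_i$; $W_i$ is an undirected clique if $U_{ii}=1$ and independent otherwise; for $i\ne j$, all $w_iw_j$ ($w_i\in W_i,w_j\in W_j$) are undirected edges if $U_{ij}=1$, all are directed edges $w_i\to w_j$ if $D_{ij}=2$, and there are none otherwise. $\Delta_r=\{\mathbf y\in\mathbb R^r_{\ge0}:\|\mathbf y\|_1=1\}$. For $\rho>1$, $A_\rho=U+\rho D$ and $g_\rho(A)=\max_{\mathbf y\in\Delta_r}\mathbf y^\intercal A_\rho\mathbf y$. $K$ denotes the size-1 matrix $([1],[0])$. $\mathcal M_F$ is the union of $\{K\}$ and the set of mixed adjacency matrices $A=(U,D)$ (of size $r$) such that: (i) $F\not\subseteq A[\![t\mathbf 1]\!]$ for all positive integers $t$; (ii) $r\le\chi(F^\rhd)-1$; (iii) $U_{ii}=0$ for all $i$; (iv) $D\ne0$; (v) $U_{ij}+U_{ji}+D_{ij}+D_{ji}>0$ for all $i\ne j$.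 (Here $F$ is collapsible since $\theta(F)>1$.) *)

(* Defs.v *)
From HB Require Import structures.
From mathcomp Require Import all_boot all_order all_algebra.
From mathcomp Require Import all_classical all_reals all_analysis.

Set Implicit Arguments.
Unset Strict Implicit.
Unset Printing Implicit Defensive.

Import Order.TTheory GRing.Theory Num.Theory.

Local Open Scope classical_set_scope.
Local Open Scope ring_scope.

Record mgraph (V : finType) := MGraph {
  und : rel V;
  dir : rel V; (* dir u v : the directed edge with tail u and head v *)
  und_sym : symmetric und;
  und_irr : irreflexive und;
  dir_asym : forall u v, dir u v -> ~~ dir v u;
  und_dir : forall u v, und u v -> ~~ dir u v }.

Section Graphs.
Variable V : finType.
Implicit Type G : mgraph V.

Definition adj G : rel V := fun u v => [|| und G u v, dir G u v | dir G v u].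

Definition und_edges G : {set {set V}} :=
  [set [set p.1; p.2] | p : V * V & und G p.1 p.2]%SET.

Definition dir_edges G : {set V * V} := [set p | dir G p.1 p.2]%SET.

Definition alpha (R : realType) G : R := #|und_edges G|%:R / 'C(#|V|, 2)%:R.
Definition beta (R : realType) G : R := #|dir_edges G|%:R / 'C(#|V|, 2)%:R.

Definition heads G : {set V} := [set v | [exists u, dir G u v]]%SET.
Definition tails G : {set V} := [set u | [exists v, dir G u v]]%SET.

Definition colorable G (k : nat) : bool :=
  [exists c : {ffun V -> 'I_k},
    [forall u, forall v, adj G u v ==> (c u != c v)]].

Lemma adj_irr G : irreflexive (adj G).
Proof.
move=> u; rewrite /adj und_irr orbb /=.
by apply/negbTE/negP => Huu; have := dir_asym Huu; rewrite Huu.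
Qed.

Lemma colorable_card G : exists k, colorable G k.
Proof.
exists #|V|; apply/existsP; exists [ffun v => enum_rank v].
apply/forallP => u; apply/forallP => v; apply/implyP => Huv.
rewrite !ffunE; apply: contraTneq Huv => /enum_rank_inj ->.
by rewrite adj_irr.
Qed.

Definition chi G : nat := ex_minn (colorable_card G).

End Graphs.

Definition contains (V W : finType) (F : mgraph V) (G : mgraph W) : Prop :=
  exists phi : V -> W,
    [/\ injective phi,
        forall u v, und F u v -> adj G (phi u) (phi v) &
        forall u v, dir F u v -> dir G (phi u) (phi v)].

Definition is_max d (T : porderType d) (S : set T) (m : T) : Prop :=
  S m /\ ubound S m.
Definition is_min d (T : porderType d) (S : set T) (m : T) : Prop :=
  S m /\ lbound S m.

Section Theta.
Variables (R : realType) (V : finType) (F : mgraph V).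

Definition free_graphs (n : nat) : set (mgraph 'I_n) :=
  [set G | ~ contains F G].
Arguments free_graphs : clear implicits.

(* The suprema below range over finitely many values, hence are maxima
   (whenever some F-free graph exists, e.g. if F has a directed edge). *)
Definition max_density (rho : R) (n : nat) : \bar R :=
  ereal_sup [set (alpha R G + rho * beta R G)%:E | G in free_graphs n].

Definition max_beta (n : nat) : \bar R :=
  ereal_sup [set (beta R G)%:E | G in free_graphs n].

Definition admissible : set R :=
  [set rho | (limn_esup (max_density rho) <= 1)%E].

(* The default value 0 of xget would only be returned if admissible had no
   maximum; as it is excluded by 1 < theta, that hypothesis includes the
   existence of the maximum. *)
Definition theta : \bar R :=
  if `[< max_beta @ \oo --> 0%E >] then +oo%E
  else (xget 0 [set rho | is_max admissible rho])%:E.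

End Theta.

Section Contraction.
Variables (V : finType) (F : mgraph V).

(* The vertices of the contraction: those of V_0, then h = inr true and
   t = inr false. The construction is total, but is the intended one only for
   collapsible F with a directed edge; 1 < theta forces F to be collapsible. *)
Definition contr_vertex : finType :=
  ({v : V | v \notin heads F :|: tails F} + bool)%type.

Definition contr_und (a b : contr_vertex) : bool :=
  match a, b with
  | inl w, inl w' => und F (val w) (val w')
  | inl w, inr c | inr c, inl w =>
      [exists u in (if c then heads F else tails F), adj F (val w) u]
  | inr _, inr _ => false
  end.

Definition contr_dir (a b : contr_vertex) : bool :=
  match a, b with
  | inl w, inl w' => dir F (val w) (val w')
  | inr false, inr true => true
  | _, _ => false
  end.

Lemma contr_und_sym : symmetric contr_und.
Proof. by case=> [w|[]] [w'|[]] //=; rewrite und_sym. Qed.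

Lemma contr_und_irr : irreflexive contr_und.
Proof. by case=> [w|c] //=; rewrite und_irr. Qed.

Lemma contr_dir_asym a b : contr_dir a b -> ~~ contr_dir b a.
Proof. by case: a b => [w|[]] [w'|[]] //=; exact: dir_asym. Qed.

Lemma contr_und_dir a b : contr_und a b -> ~~ contr_dir a b.
Proof. by case: a b => [w|[]] [w'|[]] //=; exact: und_dir. Qed.

Definition F_rhd : mgraph contr_vertex :=
  MGraph contr_und_sym contr_und_irr contr_dir_asym contr_und_dir.

End Contraction.

Record mixed_adj (R : realType) := MixedAdj {
  msize : nat;
  mU : 'M[R]_msize;
  mD : 'M[R]_msize;
  mU_sym : mU^T = mU;
  mU_01 : forall i j, mU i j = 0 \/ mU i j = 1;
  mD_02 : forall i j, mD i j = 0 \/ mD i j = 2;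
  mD_asym : forall i j, mD i j <> 0 -> mD j i = 0;
  mUD : forall i j, mU i j = 0 \/ mD i j = 0 }.

Section Blowup.
Variables (R : realType) (A : mixed_adj R) (x : 'I_(msize A) -> nat).

Definition blow_vertex : finType := {i : 'I_(msize A) & 'I_(x i)}.

Definition blow_und (p q : blow_vertex) : bool :=
  (p != q) && (mU A (tag p) (tag q) == 1).

Definition blow_dir (p q : blow_vertex) : bool :=
  mD A (tag p) (tag q) == 2.

Lemma blow_und_sym : symmetric blow_und.
Proof.
by move=> p q; rewrite /blow_und eq_sym -[in LHS](mU_sym A) mxE.
Qed.

Lemma blow_und_irr : irreflexive blow_und.
Proof. by move=> p; rewrite /blow_und eqxx. Qed.

Lemma blow_dir_asym p q : blow_dir p q -> ~~ blow_dir q p.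
Proof.
rewrite /blow_dir => /eqP Hpq; rewrite mD_asym ?Hpq; last first.
  by apply/eqP; rewrite pnatr_eq0.
by rewrite eq_sym pnatr_eq0.
Qed.

Lemma blow_und_dir p q : blow_und p q -> ~~ blow_dir p q.
Proof.
rewrite /blow_und /blow_dir => /andP[_ /eqP HU].
have [H0|->] := mUD (tag p) (tag q); last by rewrite eq_sym pnatr_eq0.
by move/eqP: HU; rewrite H0 eq_sym oner_eq0.
Qed.

Definition blowup : mgraph blow_vertex :=
  MGraph blow_und_sym blow_und_irr blow_dir_asym blow_und_dir.

End Blowup.

Section Optimization.
Variable R : realType.

Definition simplex (r : nat) : set 'cV[R]_r :=
  [set y : 'cV[R]_r | (forall i, 0 <= y i 0) /\ \sum_i `|y i 0| = 1].

Definition qform (r : nat) (M : 'M[R]_r) (y : 'cV[R]_r) : R :=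
  (y^T *m M *m y) 0 0.

(* Suprema of a continuous function on a compact set, hence maxima. *)
Definition g (rho : R) (A : mixed_adj R) : R :=
  sup [set qform (mU A + rho *: mD A) y | y in @simplex (msize A)].

Definition theta_ratio (B : mixed_adj R) (y : 'cV[R]_(msize B)) : \bar R :=
  if qform (mD B) y == 0 then +oo%E
  else ((1 - qform (mU B) y) / qform (mD B) y)%:E.

Definition ratios (B : mixed_adj R) : set (\bar R) :=
  [set theta_ratio y | y in @simplex (msize B)].

Definition ratio_min (B : mixed_adj R) : \bar R := ereal_inf (ratios B).

Lemma K_sym : (1%:M : 'M[R]_1)^T = 1%:M.
Proof. exact: trmx1. Qed.

Lemma K_01 (i j : 'I_1) :
  (1%:M : 'M[R]_1) i j = 0 \/ (1%:M : 'M[R]_1) i j = 1.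
Proof. by right; rewrite !ord1 mxE. Qed.

Lemma K_02 (i j : 'I_1) : (0 : 'M[R]_1) i j = 0 \/ (0 : 'M[R]_1) i j = 2.
Proof. by left; rewrite mxE. Qed.

Lemma K_asym (i j : 'I_1) : (0 : 'M[R]_1) i j <> 0 -> (0 : 'M[R]_1) j i = 0.
Proof. by rewrite !mxE. Qed.

Lemma K_UD (i j : 'I_1) :
  (1%:M : 'M[R]_1) i j = 0 \/ (0 : 'M[R]_1) i j = 0.
Proof. by right; rewrite mxE. Qed.

Definition K : mixed_adj R := MixedAdj K_sym K_01 K_02 K_asym K_UD.

Definition MF (V : finType) (F : mgraph V) : set (mixed_adj R) :=
  [set K] `|`
  [set A | [/\ forall t : nat, (0 < t)%N ->
                 ~ contains F (blowup (fun _ : 'I_(msize A) => t)),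
               (msize A <= chi (F_rhd F) - 1)%N,
               forall i, mU A i i = 0,
               mD A <> 0 &
               forall i j, i != j ->
                 0 < mU A i j + mU A j i + mD A i j + mD A j i]].

End Optimization.

Arguments K {R}.
Arguments MF R {V} F.

(* Main.v *)
Require Import Defs.
From mathcomp Require Import all_boot all_order all_algebra.
From mathcomp Require Import all_classical all_reals all_analysis.
From mathcomp Require Import perm lra zify.

Set Implicit Arguments.
Unset Strict Implicit.
Unset Printing Implicit Defensive.

Import Order.TTheory GRing.Theory Num.Theory.
Import numFieldNormedType.Exports.

Local Open Scope classical_set_scope.
Local Open Scope ring_scope.

(** If B is an admissible matrix and q(y) = y^T (U + rho D) y > 1 for some y in
    the simplex, colouring the vertices of 'I_n at random with law y gives
    F-free graphs of mean density exactly q(y), so rho is not admissible; hence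
    theta <= ratio(B, y). The same computation applied to a clique joined by
    directed edges to an independent set shows that F is collapsible.

    Conversely, let rho > theta, so that there are arbitrarily large F-free
    graphs G of density > 1 + e. For a fixed large m a positive proportion of
    the m-tuples of vertices of G induces a mixed graph H of weight > m^2, and
    by pigeonhole a positive proportion induces the same H. By the box theorem
    of Erdos for m-partite m-uniform hypergraphs, G contains a blow-up of H, so
    there is no homomorphism from F to H. Zykov symmetrization of the weights
    on H leaves a complete support, which yields an element B of M_F with
    g_rho(B) > 1; its size is below the chromatic number of the contraction of
    F since a colouring of the contraction would give a homomorphism from F to
    B. There are finitely many such B, so a single one works for every
    rho > theta. *)

(** * Random vertex maps and edge densities *)

Section RandomMap.
Variables (R : realType) (T I : finType) (y : I -> R).
Hypothesis y_sum1 : \sum_i y i = 1.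

Lemma sum_prod_weight : \sum_(c : {ffun T -> I}) \prod_w y (c w) = 1.
Proof.
rewrite -(bigA_distr_bigA (fun=> y)) big1 // => w _; exact: y_sum1.
Qed.

(** For [u != v] the colours [c u] and [c v] are independent with law [y]. Fixing their values [i],
    [j] by indicators turns the summand into a product over the vertices, which exchanges with the
    sum over [c]. *)
Lemma expect_pair (f : I -> I -> R) (u v : T) : u != v ->
  \sum_(c : {ffun T -> I}) (\prod_w y (c w)) * f (c u) (c v) =
  \sum_i \sum_j y i * y j * f i j.
Proof.
move=> uv; pose G i j w k : R :=
  y k * ((w == u) ==> (k == i))%:R * ((w == v) ==> (k == j))%:R.
transitivity (\sum_i \sum_j f i j * \sum_(c : {ffun T -> I}) \prod_w G i j w (c w)).
  transitivity (\sum_(c : {ffun T -> I}) \sum_i \sum_j f i j *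
                \prod_w G i j w (c w)).
    apply: eq_bigr => c _.
    rewrite (bigD1 (c u)) //= (bigD1 (c v)) //= [X in _ + X + _]big1; last first.
      move=> j jv; rewrite (bigD1 v) //= {1}/G eqxx implyTb.
      by rewrite [c v == j]eq_sym (negbTE jv) !(mulr0, mul0r).
    rewrite [X in _ + X]big1 ?addr0; last first.
      move=> i iu; apply: big1 => j _; rewrite (bigD1 u) //= {1}/G eqxx implyTb.
      by rewrite [c u == i]eq_sym (negbTE iu) !(mulr0, mul0r).
    rewrite mulrC; congr (_ * _); apply: eq_bigr => w _; rewrite /G.
    have -> : (w == u) ==> (c w == c u) by apply/implyP => /eqP->.
    have -> : (w == v) ==> (c w == c v) by apply/implyP => /eqP->.
    by rewrite !mulr1.
  rewrite exchange_big; apply: eq_bigr => i _.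
  by rewrite exchange_big; apply: eq_bigr => j _; rewrite mulr_sumr.
apply: eq_bigr => i _; apply: eq_bigr => j _.
rewrite -(bigA_distr_bigA (G i j)) mulrC; congr (_ * _).
have sum_delta k0 : \sum_k y k * (k == k0)%:R = y k0.
  rewrite (bigD1 k0) //= eqxx mulr1 big1 ?addr0 // => k kk0.
  by rewrite (negbTE kk0) mulr0.
rewrite (bigD1 u) //= (bigD1 v) /=; last by rewrite eq_sym.
rewrite [X in _ * (_ * X)]big1 ?mulr1; last first.
  move=> w /andP[wu wv]; rewrite -[RHS]y_sum1; apply: eq_bigr => k _.
  by rewrite /G (negbTE wu) (negbTE wv) !mulr1.
congr (_ * _); rewrite -[RHS]sum_delta; apply: eq_bigr => k _; rewrite /G eqxx.
  by rewrite (negbTE uv) /= mulr1.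
by rewrite [v == u]eq_sym (negbTE uv) /= mulr1.
Qed.

End RandomMap.

Lemma exists_ge_mean (R : realType) (T : finType) (p X : T -> R) (a : R) :
  (forall c, 0 <= p c) -> \sum_c p c = 1 -> a <= \sum_c p c * X c ->
  exists c, a <= X c.
Proof.
move=> p0 p1 aX; apply: contrapT => /forallNP H.
have Xa c : X c < a by rewrite ltNge; apply/negP/H.
have [c /andP[_ pc]] : exists c, true && (0 < p c).
  by apply: (@psumr_neq0P _ _ xpredT) => //; rewrite p1; exact/eqP/oner_neq0.
suff : \sum_c p c * X c < a by rewrite ltNge aX.
rewrite -[ltRHS]mul1r -p1 mulr_suml (bigD1 c) //= [ltRHS](bigD1 c) //=.
apply: ltr_leD; first by rewrite ltr_pM2l.
by apply: ler_sum => i _; rewrite ler_wpM2l // ltW.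
Qed.

(* An undirected edge is seen by two ordered pairs and a directed edge by only
   one, hence the factor 2 on the directed part. *)
Definition pair_weight (R : realType) (rho : R) (I : Type) (U D : rel I) i j : R :=
  (U i j)%:R + 2 * rho * (D i j)%:R.

Definition weight (R : realType) (rho : R) (V : finType) (G : mgraph V) : R :=
  \sum_u \sum_v pair_weight rho (und G) (dir G) u v.

Lemma card_rel_sum (R : realType) (V : finType) (r : rel V) :
  \sum_u \sum_v (r u v)%:R = #|[set p : V * V | r p.1 p.2]%SET|%:R :> R.
Proof.
rewrite pair_big /= -sum1_card natr_sum [RHS]big_mkcond /=.
by apply: eq_bigr => p _; rewrite inE; case: ifP.
Qed.

(** The fibre of [h] over an undirected edge is [{(a, b), (b, a)}], of size 2 because [und G] is
    irreflexive. *)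
Lemma card_und_edges (V : finType) (G : mgraph V) :
  #|[set p : V * V | und G p.1 p.2]%SET| = (#|und_edges G| * 2)%N.
Proof.
pose h (p : V * V) : {set V} := [set p.1; p.2]%SET.
rewrite -sum1_card (partition_big h (mem (und_edges G))) /=; last first.
  by move=> p; rewrite !inE => Hp; rewrite /und_edges; apply/imsetP; exists p; rewrite ?inE.
rewrite -[RHS]sum_nat_const; apply: eq_bigr => e /imsetP[[a b]] /= Hab ->.
rewrite sum1_card.
have Hab' : und G a b by move: Hab; rewrite inE.
have ab : a != b by apply: contraTneq Hab' => ->; rewrite und_irr.
rewrite (_ : 2%N = #|[set (a, b); (b, a)]%SET|); last first.
  by rewrite cards2 xpair_eqE (negbTE ab).
apply: eq_card => -[c d]; rewrite [LHS]unfold_in /= finset.in_set !inE /= !xpair_eqE /h /=.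
apply/andP/idP => [[Hcd /eqP E]|].
  have /setP/(_ c) := E; have /setP/(_ d) := E.
  have cd : c != d. by apply: contraTneq Hcd => ->; rewrite und_irr.
  rewrite !finset.in_set2 !eqxx ?orbT => /esym/orP[]/eqP Ed /esym/orP[]/eqP Ec;
    by move: cd; rewrite Ed Ec ?eqxx ?orbT.
by case/orP => /andP[/eqP-> /eqP->]; rewrite ?Hab' // und_sym Hab' finset.setUC.
Qed.

Lemma weightE (R : realType) (rho : R) (V : finType) (G : mgraph V) :
  weight rho G = 2 * (#|und_edges G|%:R + rho * #|dir_edges G|%:R).
Proof.
rewrite /weight /pair_weight; under eq_bigr do rewrite big_split -mulr_sumr.
rewrite big_split -mulr_sumr /= !card_rel_sum card_und_edges natrM /dir_edges.
lra.
Qed.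

(** This includes graphs with fewer than two vertices, where both sides divide by zero and
    vanish. *)
Lemma density_weight (R : realType) (rho : R) (V : finType) (G : mgraph V) :
  alpha R G + rho * beta R G = weight rho G / (#|V|%:R * (#|V|%:R - 1)).
Proof.
rewrite /alpha /beta weightE.
have -> : #|V|%:R * (#|V|%:R - 1) = 2 * 'C(#|V|, 2)%:R :> R.
  have [->|V0] := posnP #|V|; first by rewrite bin0n mul0r mulr0.
  rewrite -natrM mul2n bin2 halfK.
  have -> : odd (#|V| * #|V|.-1) = false.
    by rewrite oddM -[X in odd X && _](prednK V0) /= andNb.
  by rewrite subn0 natrM -subn1 natrB.
by rewrite -mulf_div divff ?pnatr_eq0 // mul1r mulrDl mulrA.
Qed.

(** * Inflating a pattern along a vertex map *)

Section Inflate.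
Variables (I : finType) (U D : rel I).
Hypotheses (Usym : symmetric U) (Dasym : forall i j, D i j -> ~~ D j i).
Hypothesis UD : forall i j, U i j -> ~~ D i j.
Variables (T : finType) (c : T -> I).

Let iund : rel T := fun u v => (u != v) && U (c u) (c v).
Let idir : rel T := fun u v => D (c u) (c v).

Let iund_sym : symmetric iund.
Proof. by move=> u v; rewrite /iund eq_sym Usym. Qed.
Let iund_irr : irreflexive iund.
Proof. by move=> u; rewrite /iund eqxx. Qed.
Let idir_asym u v : idir u v -> ~~ idir v u.
Proof. exact: Dasym. Qed.
Let iund_dir u v : iund u v -> ~~ idir u v.
Proof. by case/andP => _; exact: UD. Qed.

(** The fibres of [c] are the blow-up classes. Where [U] holds on the diagonal the class becomes a
    clique; the test [u != v] in [iund] removes the loops. *)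
Definition inflate : mgraph T := MGraph iund_sym iund_irr idir_asym iund_dir.

Lemma weight_inflate (R : realType) (rho : R) :
  weight rho inflate =
  \sum_u \sum_(v | u != v) pair_weight rho U D (c u) (c v).
Proof.
apply: eq_bigr => u _; rewrite [LHS](bigID (fun v => u != v)) /=.
rewrite [X in _ + X]big1 ?addr0; last first.
  move=> v /negPn/eqP<-; rewrite /pair_weight /= /iund /idir eqxx.
  suff -> : D (c u) (c u) = false by rewrite mulr0 addr0.
  by apply/negP => Duu; have := Dasym Duu; rewrite Duu.
by apply: eq_bigr => v uv; rewrite /pair_weight /= /iund uv.
Qed.

End Inflate.

(** By linearity and [expect_pair], each ordered pair of distinct vertices contributes [q]. The
    number of such pairs is the denominator in [density_weight], so mean densities are exact. *)
Lemma mean_weight_inflate (R : realType) (rho : R) (I T : finType) (U D : rel I)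
  Usym Dasym UD (y : I -> R) : \sum_i y i = 1 ->
  \sum_(c : {ffun T -> I})
     (\prod_w y (c w)) * weight rho (@inflate I U D Usym Dasym UD T c) =
  #|T|%:R * (#|T|%:R - 1) *
    \sum_i \sum_j y i * y j * pair_weight rho U D i j.
Proof.
move=> y1; set q := \sum_i _.
under eq_bigr do rewrite weight_inflate mulr_sumr.
rewrite exchange_big /=.
transitivity (\sum_(u : T) \sum_(v : T | u != v) q).
  apply: eq_bigr => u _; under eq_bigr do rewrite mulr_sumr.
  by rewrite exchange_big /=; apply: eq_bigr => v uv; rewrite expect_pair.
have E (u : T) : \sum_(v : T | u != v) q = (#|T|%:R - 1) * q.
  rewrite sumr_const -[LHS]mulr_natl; congr (_ * _).
  have := cardC1 u; rewrite (@eq_card _ (predC1 u) (fun v => u != v)); last first.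
    by move=> v; rewrite !inE eq_sym.
  move=> ->; rewrite -subn1 natrB //; apply/card_gt0P; by exists u.
by under eq_bigr do rewrite E; rewrite sumr_const -[LHS]mulr_natl mulrA.
Qed.

(** * Admissibility in terms of densities of [F]-free graphs *)

Lemma not_admissible_of_density (R : realType) (V : finType) (F : mgraph V) (rho q : R) :
  1 < q ->
  (forall n, (2 <= n)%N -> exists G : mgraph 'I_n,
     ~ contains F G /\ q <= alpha R G + rho * beta R G) ->
  ~ admissible F rho.
Proof.
move=> q1 H; rewrite /admissible /= => /(le_trans _) lim1.
suff : (q%:E <= 1%:E)%E by rewrite lee_fin leNgt q1.
apply: lim1; rewrite /limn_esup limf_esupE.
apply: le_ereal_inf_tmp => _ [A [N _ NA] <-].
have [G [FG qG]] := H (maxn 2 N) (leq_maxl _ _).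
apply: le_ereal_sup_tmp; exists (max_density F rho (maxn 2 N)).
  by exists (maxn 2 N) => //; apply: NA; exact: leq_maxr.
apply: le_ereal_sup_tmp; exists (alpha R G + rho * beta R G)%:E.
  by exists G.
by rewrite lee_fin.
Qed.

Lemma density_of_not_admissible (R : realType) (V : finType) (F : mgraph V) (rho : R) :
  ~ admissible F rho -> exists2 e : R, 0 < e &
  forall N, exists n (G : mgraph 'I_n),
    [/\ (N <= n)%N, ~ contains F G & 1 + e < alpha R G + rho * beta R G].
Proof.
move=> H; apply: contrapT => /forall2NP H2; apply: H.
rewrite /admissible /=; apply/lee_addgt0Pr => e e0.
case: (H2 e) => // /existsNP[N /forallNP HN].
rewrite /limn_esup limf_esupE.
apply: ge_ereal_inf.
exists (ereal_sup (max_density F rho @` [set k | (N <= k)%N])).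
  by exists [set k | (N <= k)%N] => //; exists N.
apply: ge_ereal_sup => _ [n /= Nn <-].
apply: ge_ereal_sup => _ [G FG <-].
rewrite lee_fin leNgt; apply/negP => Gd; apply: (HN n).
by exists G.
Qed.

(** First-moment method: under a random colouring with law [y] the mean density of the inflated
    pattern is the value of the form, so some colouring attains at least that value. *)
Lemma not_admissible_of_model (R : realType) (V : finType) (F : mgraph V) (rho : R)
  (I : finType) (U D : rel I) Usym Dasym UD (y : I -> R) :
  (forall i, 0 <= y i) -> \sum_i y i = 1 ->
  1 < \sum_i \sum_j y i * y j * pair_weight rho U D i j ->
  (forall n (c : 'I_n -> I), ~ contains F (@inflate I U D Usym Dasym UD _ c)) ->
  ~ admissible F rho.
Proof.
move=> y0 y1 q1 Ffree; apply: (not_admissible_of_density (F := F) (rho := rho) q1) => n n2.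
pose p (c : {ffun 'I_n -> I}) : R := \prod_w y (c w).
have p0 c : 0 <= p c by apply: prodr_ge0.
pose X (c : {ffun 'I_n -> I}) := weight rho (inflate Usym Dasym UD c).
have [c Hc] := exists_ge_mean p0 (sum_prod_weight _ y1)
  (lexx (\sum_c p c * X c)).
rewrite mean_weight_inflate // in Hc.
exists (inflate Usym Dasym UD c); split; first exact: Ffree.
rewrite density_weight; rewrite card_ord in Hc *.
have n0 : 0 < n%:R * (n%:R - 1) :> R.
  by rewrite mulr_gt0 ?subr_gt0 ?ltr1n ?ltr0n // ltnW.
by rewrite ler_pdivlMr // mulrC.
Qed.

(** * The box theorem *)

Section FunctionCons.
Variables (V : finType) (m : nat).

Definition fcons (v : V) (x : {ffun 'I_m -> V}) : {ffun 'I_m.+1 -> V} :=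
  [ffun i => if unlift ord0 i is Some j then x j else v].

Lemma card_fcons (S : {set {ffun 'I_m.+1 -> V}}) :
  #|S| = (\sum_x #|[set v | fcons v x \in S]%SET|)%N.
Proof.
pose h (p : V * {ffun 'I_m -> V}) := fcons p.1 p.2.
pose k (f : {ffun 'I_m.+1 -> V}) := (f ord0, [ffun j => f (lift ord0 j)]).
have hk : cancel h k.
  case=> v x; rewrite /h /k /= ffunE unlift_none; congr (_, _).
  by apply/ffunP => j; rewrite !ffunE liftK.
have kh : cancel k h.
  move=> f; apply/ffunP => i; rewrite /h /k /= ffunE.
  by case: unliftP => [j|] ->; rewrite ?ffunE.
rewrite -sum1_card big_mkcond (reindex h) /=; last by exists k => ? _.
rewrite -(pair_bigA _ (fun v x => if fcons v x \in S then 1 else 0)%N) /=.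
rewrite exchange_big; apply: eq_bigr => x _.
rewrite -sum1_card [RHS]big_mkcond; apply: eq_bigr => v _.
by rewrite finset.in_set.
Qed.

End FunctionCons.

(** A reverse Markov inequality: points outside the set contribute at most [c / 2 * M] each, points
    inside at most [M]. *)
Lemma card_ge_half_mean (R : realType) (X : finType) (f : X -> R) (c M : R) :
  0 <= c -> 0 < M -> (forall x, f x <= M) -> c * M * #|X|%:R <= \sum_x f x ->
  c / 2 * #|X|%:R <= #|[set x | c / 2 * M <= f x]%SET|%:R.
Proof.
move=> c0 M0 fM Hf; set A := [set x | _]%SET.
have : \sum_x f x <= M * #|A|%:R + c / 2 * M * #|X|%:R.
  have -> : M * #|A|%:R = \sum_x (if x \in A then M else 0).
    by rewrite -big_mkcond sumr_const mulr_natr.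
  have -> : c / 2 * M * #|X|%:R = \sum_(x : X) c / 2 * M.
    by rewrite sumr_const mulr_natr.
  rewrite -big_split /=; apply: ler_sum => x _; rewrite finset.in_set.
  case: (leP (c / 2 * M) (f x)) => [_|/ltW fx]; last by rewrite add0r.
  by rewrite (le_trans (fM x)) // lerDl mulr_ge0 ?divr_ge0 // ltW.
move=> /(le_trans Hf) H; rewrite -(ler_pM2l M0); lra.
Qed.

Lemma ffact_lower n t k : (k <= t)%N -> ((n - t) ^ k <= n ^_ k)%N.
Proof.
elim: k => [|k IH] kt //; rewrite expnSr ffactnSr.
by apply: leq_mul; [exact/IH/ltnW|rewrite leq_sub2l // ltnW].
Qed.

(** Double counting of the pairs [(w, x)]: for fixed [x], the suitable [w] are the injections into
    the set of [v] with [fcons v x] in [S]. *)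
Lemma card_fcons_box (V : finType) m t (S : {set {ffun 'I_m.+1 -> V}}) :
  (\sum_(w : {ffun 'I_t -> V} | injectiveb w)
     #|[set x | [forall k, fcons (w k) x \in S]]%SET| =
   \sum_x #|[set v | fcons v x \in S]%SET| ^_ t)%N.
Proof.
transitivity (\sum_(w : {ffun 'I_t -> V} | injectiveb w) \sum_x
   if [forall k, fcons (w k) x \in S] then 1 else 0)%N.
  apply: eq_bigr => w _; rewrite -sum1_card big_mkcond.
  by apply: eq_bigr => x _; rewrite finset.in_set.
rewrite exchange_big /=; apply: eq_bigr => x _.
have := card_inj_ffuns_on 'I_t (mem [set v | fcons v x \in S]%SET).
rewrite card_ord => <-.
rewrite -sum1_card big_mkcond [RHS]big_mkcond; apply: eq_bigr => w _.
rewrite !finset.in_set andbC; case: (injectiveb w) => //=.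
rewrite (_ : [forall k, _] = (w \in ffun_on (mem [set v | fcons v x \in S]%SET))) //.
by apply/forallP/ffun_onP => H k; have := H k; rewrite finset.in_set.
Qed.

(** Induction on [m]. Averaging over [w : 'I_t -> V] yields [t] distinct first coordinates whose
    common extensions still have positive density; the induction hypothesis finds the other classes
    among these extensions. *)
Theorem dense_box (R : realType) (t m : nat) (c : R) : 0 < c ->
  exists N, forall (V : finType) (S : {set {ffun 'I_m -> V}}), (N <= #|V|)%N ->
    c * #|V|%:R ^+ m <= #|S|%:R ->
    exists w : 'I_m -> 'I_t -> V, (forall i, injective (w i)) /\
      forall k : 'I_m -> 'I_t, [ffun i => w i (k i)] \in S.
Proof.
elim: m c => [|m IH] c c0.
  exists 0%N => V S _; rewrite expr0 mulr1 => cS.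
  have /card_gt0P[f fS] : (0 < #|S|)%N by rewrite -(ltr0n R) (lt_le_trans c0).
  exists (fun i _ => f i); split => [[]//|k].
  by rewrite (_ : [ffun i => _] = f) //; apply/ffunP => -[].
(* A proportion [c / 2] of the [x] has at least [c / 2 * #|V|] first coordinates, and each such [x]
   is compatible with at least [(c / 4 * #|V|) ^+ t] injective [w]. *)
pose c1 := c / 2 * (c / 4) ^+ t.
have c10 : 0 < c1 by rewrite mulr_gt0 ?exprn_gt0 ?divr_gt0.
have [N1 HN1] := IH _ c10.
(* The second bound gives [t <= c / 4 * #|V|], the loss allowed in passing from powers to falling
   factorials. *)
pose N := (maxn N1 (Num.truncn (4 * t%:R / c)).+1).
exists N => V S; rewrite geq_max => /andP[VN1 VN] cS.
have n0 : 0 < #|V|%:R :> R by rewrite ltr0n; exact: leq_trans VN.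
have tn : t%:R <= c / 4 * #|V|%:R.
  have : 4 * t%:R / c <= #|V|%:R.
    apply: le_trans (ltW (truncnS_gt _)) _; first by rewrite ler_nat.
  by rewrite ler_pdivrMr //; lra.
pose d x := #|[set v | fcons v x \in S]%SET|.
pose A := [set x : {ffun 'I_m -> V} | c / 2 * #|V|%:R <= (d x)%:R]%SET.
have cardX : #|{ffun 'I_m -> V}|%:R = #|V|%:R ^+ m :> R.
  by rewrite card_ffun card_ord natrX.
have HA : c / 2 * #|V|%:R ^+ m <= #|A|%:R.
  rewrite -cardX; apply: card_ge_half_mean => //; first exact: ltW.
    by move=> x; rewrite ler_nat max_card.
  by rewrite cardX -mulrA -exprS -natr_sum /d -card_fcons.
pose p (w : {ffun 'I_t -> V}) : R := (#|V|%:R ^+ t)^-1.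
pose X (w : {ffun 'I_t -> V}) : R := if injectiveb w then
   #|[set x | [forall k, fcons (w k) x \in S]]%SET|%:R else 0.
have [w Hw] : exists w, c1 * #|V|%:R ^+ m <= X w.
  apply: (@exists_ge_mean _ _ p).
  - by move=> w; rewrite invr_ge0 exprn_ge0 // ltW.
  - rewrite sumr_const card_ffun card_ord -[LHS]mulr_natl natrX mulfV //.
    by rewrite expf_neq0 // gt_eqF.
  rewrite -mulr_sumr ler_pdivlMl ?exprn_gt0 // -big_mkcond /= -natr_sum.
  rewrite card_fcons_box natr_sum.
  apply: (@le_trans _ _ (\sum_(x in A) (c / 4 * #|V|%:R) ^+ t)).
    rewrite sumr_const -[leRHS]mulr_natl exprMn.
    have E : 0 <= (c / 4) ^+ t * #|V|%:R ^+ t.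
      by rewrite mulr_ge0 ?exprn_ge0 ?divr_ge0 // ltW.
    apply: le_trans (ler_wpM2r E HA); rewrite /c1 le_eqVlt; apply/orP; left.
    by apply/eqP; set a := _ ^+ t; set b := _ ^+ m; set e := _ ^+ t; lra.
  rewrite big_mkcond /=; apply: ler_sum => x _; rewrite finset.in_set.
  case: ifP => // dx; apply: (@le_trans _ _ ((d x - t) ^ t)%N%:R); last first.
    by rewrite ler_nat ffact_lower.
  rewrite natrX lerXn2r ?nnegrE ?mulr_ge0 ?divr_ge0 // ?(ltW c0) //.
  have := mulr_gt0 c0 n0 => cn0.
  have td : (t <= d x)%N by rewrite -(ler_nat R); lra.
  by rewrite natrB //; lra.
have winj : injectiveb w.
  move: Hw; rewrite /X; case: ifP => // _.
  by rewrite leNgt mulr_gt0 ?exprn_gt0.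
rewrite /X winj in Hw.
have [w' [w'inj Hw']] := HN1 _ _ VN1 Hw.
exists (fun i => if unlift ord0 i is Some j then w' j else w); split.
  by move=> i; case: unlift => [j|]; [exact: w'inj|exact/injectiveP].
move=> k; have := Hw' (fun j => k (lift ord0 j)).
rewrite finset.in_set => /forallP/(_ (k ord0)); congr (_ \in S).
apply/ffunP => i; rewrite !ffunE; case: unliftP => [j|] -> //.
by rewrite ffunE.
Qed.

(** * Frequent patterns in dense F-free graphs *)

(** Injectivity is dropped: in a large blow-up, vertices with a common image can take distinct
    copies. *)
Definition mhom (V W : finType) (F : mgraph V) (H : mgraph W) : Prop :=
  exists f : V -> W,
    (forall u v, und F u v -> adj H (f u) (f v)) /\
    (forall u v, dir F u v -> dir H (f u) (f v)).

(** At most [k ^ 2 * n ^ (k - 1)] maps from [k] to [n] points fail to be injective; multiplying by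
    [n] avoids the truncated exponent. *)
Lemma expn_ffact_ub n k : (n ^ k * n <= n ^_ k * n + k * k * n ^ k)%N.
Proof.
elim: k => [|k IH]; first by rewrite expn0 ffactn0 addn0.
have H1 : (n * n ^_ k <= n ^_ k.+1 + k * n ^ k)%N.
  rewrite ffactnSr mulnC; apply: (@leq_trans (n ^_ k * ((n - k) + k))).
    by rewrite leq_mul2l addnC -leq_subLR leqnn orbT.
  rewrite mulnDr leq_add2l mulnC leq_mul2l; apply/orP; right.
  elim: (k) => [|j IHj]; first by rewrite ffactn0.
  by rewrite ffactnSr expnSr leq_mul ?leq_subr.
rewrite expnS.
have : (n * (n ^ k * n) <= n * (n ^_ k * n + k * k * n ^ k))%N.
  by rewrite leq_mul2l IH orbT.
have : (n * n ^_ k * n <= (n ^_ k.+1 + k * n ^ k) * n)%N by rewrite leq_mul2r H1 orbT.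
nia.
Qed.

Lemma pigeonhole_ge (R : realType) (X T : finType) (S : {set X}) (h : X -> T) (a : R) :
  (0 < #|T|)%N -> a <= #|S|%:R ->
  exists k, a / #|T|%:R <= #|[set x in S | h x == k]%SET|%:R.
Proof.
move=> T0 aS; apply: (@exists_ge_mean _ _ (fun=> #|T|%:R^-1)).
- by move=> _; rewrite invr_ge0.
- by rewrite sumr_const -[LHS]mulr_natl mulfV // pnatr_eq0 -lt0n.
rewrite -mulr_sumr mulrC ler_pM2l ?invr_gt0 ?ltr0n //.
rewrite -natr_sum (le_trans aS) // ler_nat -sum1_card.
rewrite (partition_big h xpredT) //=; apply: leq_sum => k _.
rewrite sum1_card; apply: eq_leq; apply: eq_card => x.
by rewrite finset.in_set.
Qed.

Lemma weight_ub (R : realType) (rho : R) m (H : mgraph 'I_m) : 0 <= rho ->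
  weight rho H <= m%:R ^+ 2 * (1 + 2 * rho).
Proof.
move=> rho0; have le1 (b : bool) : b%:R <= 1 :> R by case: b.
apply: (@le_trans _ _ (\sum_(u < m) \sum_(v < m) (1 + 2 * rho))).
  apply: ler_sum => u _; apply: ler_sum => v _; apply: lerD => //.
  by rewrite -[leRHS]mulr1 ler_wpM2l // mulr_ge0.
rewrite (eq_bigr (fun=> m%:R * (1 + 2 * rho))); last first.
  by move=> u _; rewrite sumr_const card_ord -[LHS]mulr_natl.
by rewrite sumr_const card_ord -[leLHS]mulr_natl mulrA.
Qed.

Section Sample.
Variables (n : nat) (G : mgraph 'I_n) (m : nat).

(** [f] may repeat vertices of [G]; indices with a common image are nonadjacent. *)
Definition sample (f : {ffun 'I_m -> 'I_n}) : mgraph 'I_m :=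
  inflate (@und_sym _ G) (@dir_asym _ G) (@und_dir _ G) f.

(** The mean weight of a sample is at least [m ^ 2 (1 + e / 2)], while no weight exceeds
    [m ^ 2 (1 + 2 rho)], so a positive proportion of the tuples must carry the excess over
    [m ^ 2]. *)
Lemma card_dense_sample (R : realType) (rho e : R) : 0 <= rho -> (0 < n)%N -> (0 < m)%N ->
  4 * (1 + e) <= e * m%:R -> 4 * (1 + e) <= e * n%:R -> 0 < e ->
  1 + e < alpha R G + rho * beta R G ->
  e / (2 * (1 + 2 * rho)) * n%:R ^+ m <=
    #|[set f : {ffun 'I_m -> 'I_n} | m%:R ^+ 2 < weight rho (sample f)]%SET|%:R.
Proof.
move=> rho0 n0 m0 me ne e0; rewrite density_weight card_ord => Gd.
have nR : 0 < n%:R :> R by rewrite ltr0n.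
have mR : 0 < m%:R :> R by rewrite ltr0n.
have n1 : 1 < n%:R :> R by rewrite ltNge; apply/negP => n1; nra.
have m1 : 1 < m%:R :> R by rewrite ltNge; apply/negP => m1; nra.
set S := [set f | _]%SET.
pose y (i : 'I_n) : R := n%:R^-1.
have y1 : \sum_i y i = 1.
  by rewrite sumr_const card_ord -[LHS]mulr_natl mulfV // gt_eqF.
have := mean_weight_inflate rho 'I_m (@und_sym _ G) (@dir_asym _ G) (@und_dir _ G) y1.
rewrite card_ord.
have -> : \sum_i \sum_j y i * y j * pair_weight rho (und G) (dir G) i j =
    n%:R^-1 * n%:R^-1 * weight rho G.
  rewrite mulr_sumr; apply: eq_bigr => i _; rewrite mulr_sumr.
  exact: eq_bigr.
have -> : \sum_(c : {ffun 'I_m -> 'I_n}) (\prod_w y (c w)) * weight rho (sample c) =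
    (n%:R ^+ m)^-1 * \sum_c weight rho (sample c).
  rewrite mulr_sumr; apply: eq_bigr => c _; congr (_ * _).
  by rewrite prodr_const card_ord exprVn.
move=> E.
have cardX : #|{ffun 'I_m -> 'I_n}|%:R = n%:R ^+ m :> R.
  by rewrite card_ffun !card_ord natrX.
have ub : \sum_c weight rho (sample c) <=
    m%:R ^+ 2 * n%:R ^+ m + m%:R ^+ 2 * (1 + 2 * rho) * #|S|%:R.
  have -> : m%:R ^+ 2 * (1 + 2 * rho) * #|S|%:R =
      \sum_(c : {ffun 'I_m -> 'I_n}) (if c \in S then m%:R ^+ 2 * (1 + 2 * rho) else 0).
    by rewrite -big_mkcond sumr_const mulr_natr.
  rewrite -cardX mulr_natr -sumr_const -big_split /=; apply: ler_sum => c _.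
  rewrite finset.in_set; case: ltP => H; last by rewrite addr0.
  by rewrite (le_trans (weight_ub _ rho0)) // lerDr exprn_ge0.
have nm0 : 0 < n%:R ^+ m :> R by rewrite exprn_gt0.
(* The factors [1 - 1 / n] and [1 - 1 / m] each cost at most [e / 4]. *)
have lb : m%:R ^+ 2 * (1 + e / 2) * n%:R ^+ m <= \sum_c weight rho (sample c).
  rewrite -ler_pdivlMr // [leRHS]mulrC E.
  move: Gd; rewrite ltr_pdivlMr ?mulr_gt0 ?subr_gt0 // => Gd.
  apply: (@le_trans _ _ (m%:R * (m%:R - 1) *
     (n%:R^-1 * n%:R^-1 * ((1 + e) * (n%:R * (n%:R - 1)))))); last first.
    rewrite ler_wpM2l //; first by rewrite mulr_ge0 ?subr_ge0 // ltW.
    by rewrite ler_wpM2l ?(ltW Gd) // mulr_ge0 ?invr_ge0 // ltW.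
  have -> : n%:R^-1 * n%:R^-1 * ((1 + e) * (n%:R * (n%:R - 1))) =
     (1 + e) * ((n%:R - 1) / n%:R) :> R.
    have nn : n%:R^-1 * n%:R = 1 :> R by rewrite mulVf // gt_eqF.
    transitivity (n%:R^-1 * n%:R * ((1 + e) * ((n%:R - 1) / n%:R)) : R); first lra.
    by rewrite nn mul1r.
  have a1 : (1 + e) * ((n%:R - 1) / n%:R) >= 1 + e - e / 4.
    rewrite mulrA ler_pdivlMr //; nra.
  have a2 : m%:R * (m%:R - 1) * (1 + e - e / 4) >= m%:R ^+ 2 * (1 + e / 2).
    by rewrite expr2 -!mulrA ler_pM2l //; nra.
  apply: (le_trans a2); rewrite ler_wpM2l //.
  by rewrite mulr_ge0 ?subr_ge0 // ltW.
have {lb ub} := le_trans lb ub.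
have m2 : 0 < m%:R ^+ 2 :> R by rewrite exprn_gt0.
have -> : m%:R ^+ 2 * (1 + e / 2) * n%:R ^+ m =
  m%:R ^+ 2 * n%:R ^+ m + m%:R ^+ 2 * (e / 2 * n%:R ^+ m) :> R by lra.
rewrite lerD2l -[leRHS]mulrA ler_pM2l // => H.
rewrite invfM mulrA mulrAC ler_pdivrMr; last by lra.
by rewrite [leRHS]mulrC.
Qed.

(** A vertex [v] of [F] goes to copy [r v] of class [h v]. Injectivity of [r] separates vertices
    within a class, injectivity of the tuples in [S] separates the classes. *)
Lemma contains_of_box t (S : {set {ffun 'I_m -> 'I_n}}) (w : 'I_m -> 'I_t -> 'I_n)
    (V : finType) (F : mgraph V) (r : V -> 'I_t) (f0 : {ffun 'I_m -> 'I_n}) :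
  (forall f : {ffun 'I_m -> 'I_n}, f \in S -> injective f) ->
  (forall (f : {ffun 'I_m -> 'I_n}) i j, f \in S -> und G (f i) (f j) = und G (f0 i) (f0 j)) ->
  (forall (f : {ffun 'I_m -> 'I_n}) i j, f \in S -> dir G (f i) (f j) = dir G (f0 i) (f0 j)) ->
  (forall i, injective (w i)) ->
  (forall k : 'I_m -> 'I_t, [ffun i => w i (k i)] \in S) ->
  injective r -> mhom F (sample f0) -> contains F G.
Proof.
move=> Sinj Sund Sdir winj wS rinj [h [hund hdir]].
(* Two box vertices of distinct classes lie on a common tuple of [S], hence are related in [G] as
   prescribed by [f0]. *)
have two i j a b : i != j ->
    exists2 f : {ffun 'I_m -> 'I_n}, f \in S & f i = w i a /\ f j = w j b.
  move=> ij; exists [ffun k => w k (if k == i then a else b)]; first exact: wS.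
  by rewrite !ffunE eqxx eq_sym (negbTE ij).
have adj_neq u v : adj (sample f0) u v -> u != v.
  by apply: contraTneq => ->; rewrite adj_irr.
have adjE u v : adj (sample f0) (h u) (h v) ->
    adj G (w (h u) (r u)) (w (h v) (r v)).
  move=> huv; have [f fS [<- <-]] := two _ _ (r u) (r v) (adj_neq _ _ huv).
  move: huv; rewrite /adj /= !(Sund f) // !(Sdir f) //.
  by case/or3P => [/andP[_ ->]|->|->]; rewrite ?orbT.
exists (fun v => w (h v) (r v)); split.
- move=> u v /= E; have [huv|huv] := eqVneq (h u) (h v).
    by move: E; rewrite huv => /winj/rinj.
  have [f fS [fu fv]] := two _ _ (r u) (r v) huv.
  by move: E; rewrite -fu -fv => /(Sinj _ fS) E; rewrite E eqxx in huv.
- by move=> u v /hund/adjE.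
move=> u v /hdir huv.
have [|f fS [<- <-]] := two (h u) (h v) (r u) (r v).
  by apply: adj_neq; rewrite /adj huv orbT.
by rewrite (Sdir f).
Qed.

End Sample.

Lemma pattern_of_not_admissible (R : realType) (V : finType) (F : mgraph V) (rho : R) :
  0 <= rho -> ~ admissible F rho ->
  exists m (H : mgraph 'I_m), ~ mhom F H /\ m%:R ^+ 2 < weight rho H.
Proof.
move=> rho0 /density_of_not_admissible[e e0 HG].
have [m0 Hm0] : exists m0, (0 < m0)%N /\ 4 * (1 + e) <= e * m0%:R.
  exists (Num.truncn (4 * (1 + e) / e)).+1; split => //.
  by rewrite -ler_pdivrMl // mulrC; exact/ltW/truncnS_gt.
case: Hm0 => m00 Hm; set m := m0 in m00 Hm.
(* An element of [T] records the whole mixed graph induced by a tuple. *)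
pose T := {ffun 'I_m * 'I_m -> bool * bool}.
have T0 : (0 < #|{: T}|)%N by apply/card_gt0P; exists [ffun=> (true, true)].
pose c0 := e / (2 * (1 + 2 * rho)).
have c00 : 0 < c0 by rewrite divr_gt0 // mulr_gt0 //; lra.
(* Half of [c0] is given up for the tuples with repetitions; the division by [#|{: T}|] pays for the
   pigeonhole. *)
pose c1 := c0 / 2 / #|{: T}|%:R.
have c10 : 0 < c1 by apply: divr_gt0; [exact: divr_gt0|rewrite ltr0n].
(* Classes of size [#|V|] offer one copy per vertex of [F], selected by [enum_rank]. *)
have [N1 HN1] := dense_box #|V| m c10.
pose N := maxn N1 (maxn (Num.truncn (4 * (1 + e) / e)).+1
                        (Num.truncn (2 * m%:R ^+ 2 / c0)).+1).
have [n [G [nN FG Gd]]] := HG N.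
move: nN; rewrite !geq_max => /and3P[nN1 n1 n2].
have n0 : (0 < n)%N by exact: leq_ltn_trans n1.
have nR : 0 < n%:R :> R by rewrite ltr0n.
have He : 4 * (1 + e) <= e * n%:R.
  rewrite -ler_pdivrMl // mulrC; apply: le_trans (ltW (truncnS_gt _)) _.
  by rewrite ler_nat.
have Hc : 2 * m%:R ^+ 2 <= c0 * n%:R.
  rewrite -ler_pdivrMl // mulrC; apply: le_trans (ltW (truncnS_gt _)) _.
  by rewrite ler_nat.
have := card_dense_sample rho0 n0 m00 Hm He e0 Gd; rewrite -/c0.
set S0 := [set f | _]%SET => HS0.
pose J := [set f : {ffun 'I_m -> 'I_n} | injectiveb f]%SET.
have HJ : (n ^ m <= #|J| + #|~: J|)%N.
  by rewrite cardsC card_ffun !card_ord.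
have cJ : #|J| = (n ^_ m)%N by rewrite /J card_inj_ffuns !card_ord.
(* The proportion of tuples with repetitions is at most [m ^ 2 / n], which [Hc] bounds by
   [c0 / 2]. *)
have HS1 : c0 / 2 * n%:R ^+ m <= #|S0 :&: J|%:R.
  have E0 : (n%:R ^+ m * n%:R <= #|J|%:R * n%:R + m%:R ^+ 2 * n%:R ^+ m :> R).
    by rewrite cJ -!natrX -!natrM -natrD ler_nat -mulnn expn_ffact_ub.
  have E1 : #|S0|%:R <= #|S0 :&: J|%:R + (n%:R ^+ m - #|J|%:R) :> R.
    rewrite -lerBlDl -(cardsID J S0) natrD addrAC subrr add0r lerBrDl.
    rewrite -natrX -natrD ler_nat -[X in (_ <= X)%N](_ : #|{ffun 'I_m -> 'I_n}| = _)%N;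
      last by rewrite card_ffun !card_ord.
    by rewrite -(cardsC J) leq_add2l subset_leq_card // finset.setDE finset.subsetIr.
  rewrite -(ler_pM2r nR).
  have nm0 : 0 < n%:R ^+ m :> R by rewrite exprn_gt0.
  set M := n%:R ^+ m in E0 E1 HS0 nm0 *; set n' := n%:R in E0 nR Hc *.
  have H1 : M * (2 * m%:R ^+ 2) <= M * (c0 * n') by rewrite ler_pM2l.
  have H2 : #|S0|%:R * n' <= (#|S0 :&: J|%:R + (M - #|J|%:R)) * n' by rewrite ler_pM2r.
  have H3 : c0 * M * n' <= #|S0|%:R * n' by rewrite ler_pM2r.
  lra.
pose code (f : {ffun 'I_m -> 'I_n}) : T :=
  [ffun p => (und G (f p.1) (f p.2), dir G (f p.1) (f p.2))].
have [k Hk] := pigeonhole_ge code T0 HS1.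
set S := [set x in _ | _]%SET in Hk.
have SP f : f \in S -> [/\ m%:R ^+ 2 < weight rho (sample G f), injective f & code f = k].
  rewrite !finset.in_set /= => /andP[/andP[H1 /injectiveP H2] /eqP H3]; by split.
have Hk' : c1 * #|'I_n|%:R ^+ m <= #|S|%:R.
  by apply: le_trans Hk; rewrite /c1 card_ord mulrAC.
have [|w [winj wS]] := HN1 'I_n S _ Hk'; first by rewrite card_ord.
have /card_gt0P[f0 f0S] : (0 < #|S|)%N.
  by rewrite -(ltr0n R); apply: lt_le_trans Hk'; rewrite card_ord mulr_gt0 ?exprn_gt0.
exists m, (sample G f0); split; last by have [] := SP _ f0S.
have codeE f i j : f \in S -> (und G (f i) (f j), dir G (f i) (f j)) =
    (und G (f0 i) (f0 j), dir G (f0 i) (f0 j)).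
  move=> /SP[_ _]; have [_ _ <-] := SP _ f0S.
  by move=> /ffunP/(_ (i, j)); rewrite !ffunE.
move=> FH; apply: FG; apply: (contains_of_box _ _ _ winj wS (@enum_rank_inj V) FH).
- by move=> f /SP[].
- by move=> f i j fS; case: (codeE f i j fS).
- by move=> f i j fS; case: (codeE f i j fS).
Qed.

(** * Symmetrization *)

Section Symmetrization.
Variables (R : realType) (T : finType) (W : T -> T -> R).
Hypothesis W0 : forall i, W i i = 0.

Let Q (y : T -> R) := \sum_i \sum_j y i * y j * W i j.
Let d (a b : T) (k : T) : R := (k == a)%:R - (k == b)%:R.

Let sum_d a b (f : T -> R) : \sum_k d a b k * f k = f a - f b.
Proof.
have one c : \sum_k (k == c)%:R * f k = f c.
  rewrite (bigD1 c) //= eqxx mul1r big1 ?addr0 // => k kc.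
  by rewrite (negbTE kc) mul0r.
under eq_bigr do rewrite mulrBl.
by rewrite sumrB !one.
Qed.

(* Moving weight s between two nonadjacent vertices changes Q affinely in s. *)
Let Q_shift a b y s : W a b + W b a = 0 ->
  Q (fun k => y k + s * d a b k) =
  Q y + s * (\sum_i y i * (W i a - W i b) + \sum_i y i * (W a i - W b i)).
Proof.
move=> Wab.
have E1 i : \sum_j (y i + s * d a b i) * (y j + s * d a b j) * W i j =
  \sum_j y i * y j * W i j + s * (y i * (W i a - W i b)) +
  s * (d a b i * (\sum_j y j * W i j + s * (W i a - W i b))).
  rewrite -(sum_d a b (W i)).
  rewrite [X in X + _ + _](_ : _ = y i * \sum_j y j * W i j); last first.
    by rewrite mulr_sumr; apply: eq_bigr => j _; rewrite mulrA.
  transitivity ((y i + s * d a b i) *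
     (\sum_j y j * W i j + s * \sum_j d a b j * W i j)); last by lra.
  rewrite [s * \sum_j _]mulr_sumr -big_split mulr_sumr /=.
  by apply: eq_bigr => j _; lra.
rewrite /Q; under eq_bigr do rewrite E1.
rewrite !big_split -!mulr_sumr /= sum_d.
have -> : \sum_i y i * (W a i - W b i) = \sum_j y j * W a j - \sum_j y j * W b j.
  by rewrite -sumrB; apply: eq_bigr => j _; rewrite mulrBr.
rewrite !W0 add0r subr0 (_ : W b a = - W a b); last by lra.
lra.
Qed.

(** Induction on the size of the support. By [Q_shift], for a nonadjacent pair in the support,
    moving all the weight of one end to the other does not decrease the form in at least one
    direction, and it shrinks the support. *)
Lemma symmetrize (y : T -> R) : (forall i, 0 <= y i) -> \sum_i y i = 1 ->
  exists z : T -> R, [/\ forall i, 0 <= z i, \sum_i z i = 1,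
    \sum_i \sum_j y i * y j * W i j <= \sum_i \sum_j z i * z j * W i j &
    forall i j, z i != 0 -> z j != 0 -> i != j -> W i j + W j i != 0].
Proof.
have [k] := ubnP #|[set i | y i != 0]%SET|.
elim: k y => // k IH y; rewrite ltnS => yk y0 y1.
have [H|] := EM (forall i j, y i != 0 -> y j != 0 -> i != j -> W i j + W j i != 0).
  by exists y; split.
move=> /existsNP[a /existsNP[b /not_implyP[ya /not_implyP[yb /not_implyP[ab]]]]].
move=> /negP/negPn/eqP Wab.
(* Exchanging [a] and [b] negates the slope. *)
wlog L0 : a b ya yb ab Wab / 0 <= \sum_i y i * (W i a - W i b) + \sum_i y i * (W a i - W b i).
  move=> Hw; have [|L0] := leP 0 (\sum_i y i * (W i a - W i b) + \sum_i y i * (W a i - W b i)).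
    exact: Hw.
  apply: (Hw b a) => //; [by rewrite eq_sym|by rewrite addrC|].
  rewrite (eq_bigr (fun i => - (y i * (W i a - W i b)))); last by move=> i _; lra.
  rewrite [X in _ + X](eq_bigr (fun i => - (y i * (W a i - W b i)))); last by move=> i _; lra.
  by rewrite !sumrN -opprD oppr_ge0 ltW.
pose z k := y k + y b * d a b k.
have zE i : z i = if i == a then y a + y b else if i == b then 0 else y i.
  rewrite /z /d; have [->|ia] := eqVneq i a; first by rewrite (negbTE ab) mulr1n mulr0n; lra.
  by have [->|ib] := eqVneq i b; rewrite ?mulr1n mulr0n; lra.
have [|||w [w0 w1 wz wW]] := IH z.
- apply: leq_trans yk; apply: proper_card; apply/properP; split.
    apply/fintype.subsetP => i; rewrite !finset.in_set zE.
    have [->|_] := eqVneq i a; first by rewrite ya.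
    by have [_|_] := eqVneq i b; rewrite ?eqxx.
  by exists b; rewrite !finset.in_set // zE [b == a]eq_sym (negbTE ab) !eqxx.
- by move=> i; rewrite zE; case: ifP => _; [exact: addr_ge0|case: ifP].
- rewrite big_split /= y1 -mulr_sumr -[X in _ * X](eq_bigr _ (fun i _ => mulr1 _)).
  by rewrite sum_d subrr mulr0 addr0.
exists w; split => //; apply: le_trans wz.
by have := Q_shift y (y b) Wab; rewrite /Q /z => ->; rewrite lerDl mulr_ge0.
Qed.

End Symmetrization.

Lemma qformE (R : realType) r (M : 'M[R]_r) (y : 'cV[R]_r) :
  qform M y = \sum_i \sum_j y i 0 * y j 0 * M i j.
Proof.
rewrite /qform mxE exchange_big /=; apply: eq_bigr => j _.
by rewrite mxE mulr_suml; apply: eq_bigr => i _; rewrite !mxE mulrAC.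
Qed.

Section MixedOf.
Variables (R : realType) (V : finType) (H : mgraph V) (r : nat) (e : 'I_r -> V).

Let U : 'M[R]_r := \matrix_(i, j) (und H (e i) (e j))%:R.
Let D : 'M[R]_r := \matrix_(i, j) (dir H (e i) (e j)).*2%:R.

Let U_sym : U^T = U.
Proof. by apply/matrixP => i j; rewrite !mxE und_sym. Qed.
Let U_01 i j : U i j = 0 \/ U i j = 1.
Proof. by rewrite mxE; case: und; [right|left]. Qed.
Let D_02 i j : D i j = 0 \/ D i j = 2.
Proof. by rewrite mxE; case: dir; [right|left]. Qed.
Let D_asym i j : D i j <> 0 -> D j i = 0.
Proof. by rewrite !mxE; case E: (dir H (e i) _) => // _; rewrite (negbTE (dir_asym E)). Qed.
Let UD i j : U i j = 0 \/ D i j = 0.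
Proof.
by rewrite !mxE; case E: und; [rewrite (negbTE (und_dir E)); right|left].
Qed.

(** The pattern of [H] on the vertices listed by [e]; the entries 2 make [U + rho *: D] reproduce
    [pair_weight]. *)
Definition mixed_of : mixed_adj R := MixedAdj U_sym U_01 D_02 D_asym UD.

Lemma mhom_of_contains_blowup (W : finType) (F : mgraph W) (x : 'I_r -> nat) :
  contains F (@blowup R mixed_of x) -> mhom F H.
Proof.
have und1 p q : mU mixed_of p q == 1 -> und H (e p) (e q).
  by rewrite mxE; case: und => //; rewrite eq_sym oner_eq0.
have dir2 p q : mD mixed_of p q == 2 -> dir H (e p) (e q).
  by rewrite mxE; case: dir => //; rewrite eq_sym pnatr_eq0.
case=> phi [_ Fund Fdir]; exists (fun v => e (tag (phi v))); split => u v.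
  move=> /Fund; rewrite /adj /= /blow_und /blow_dir.
  by case/or3P => [/andP[_ /und1->]|/dir2->|/dir2->]; rewrite ?orbT.
by move=> /Fdir/dir2.
Qed.

End MixedOf.

(** * Collapsibility and the size bound *)

Definition collapsible (V : finType) (F : mgraph V) : Prop :=
  (forall u v, u \in heads F -> v \in heads F -> ~~ adj F u v) /\
  (forall u v, u \in tails F -> v \in tails F -> ~~ adj F u v).

Lemma contains_adj (V W : finType) (F : mgraph V) (G : mgraph W) (phi : V -> W) :
  (forall u v, und F u v -> adj G (phi u) (phi v)) ->
  (forall u v, dir F u v -> dir G (phi u) (phi v)) ->
  forall u v, adj F u v -> adj G (phi u) (phi v).
Proof.
move=> Fund Fdir u v /or3P[/Fund//|/Fdir E|/Fdir E]; by rewrite /adj E ?orbT.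
Qed.

(* A clique all of whose vertices send (resp. receive) directed edges to (resp.
   from) a small independent set has density above 1 when rho > 1; its head
   (resp. tail) vertices are pairwise nonadjacent. *)
Lemma collapsible_of_admissible (R : realType) (V : finType) (F : mgraph V) (rho : R) :
  1 < rho -> admissible F rho -> collapsible F.
Proof.
move=> rho1 adm.
pose U (i j : bool) := i && j.
have Usym : symmetric U by move=> [] [].
(* With mass [s] on the independent side the form equals [1 + 2 (rho - 1) s - (2 rho - 1) s ^ 2];
   this [s] maximises it, with value [1 + (rho - 1) s]. *)
pose s := (rho - 1) / (2 * rho - 1).
have rho2 : 0 < 2 * rho - 1 by lra.
have sE : s * (2 * rho - 1) = rho - 1 by rewrite divfK // gt_eqF.
have s0 : 0 < s by rewrite divr_gt0 // subr_gt0.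
have s1 : s <= 1 by rewrite ler_pdivrMr //; lra.
pose y (i : bool) : R := if i then 1 - s else s.
have y0 i : 0 <= y i by case: i; rewrite /y; lra.
have y1 : \sum_i y i = 1 by rewrite big_bool /y /=; lra.
have srho : 0 < s * (rho - 1) by rewrite mulr_gt0 // subr_gt0.
have sE2 : s * (s * (2 * rho - 1)) = s * (rho - 1) by rewrite sE.
split=> u v; rewrite finset.in_set => /existsP[u' uu'];
  rewrite finset.in_set => /existsP[v' vv']; apply/negP => uv.
- pose D (i j : bool) := i && ~~ j.
  have Dasym i j : D i j -> ~~ D j i by case: i j => [] [].
  have UD i j : U i j -> ~~ D i j by case: i j => [] [].
  move: adm; apply: (not_admissible_of_model (Usym := Usym) (Dasym := Dasym) (UD := UD) y0 y1) => [|n c].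
    by rewrite !big_bool /pair_weight /U /D /y /= !mulr1n !mulr0n; lra.
  case=> phi [_ Fund Fdir]; have := contains_adj Fund Fdir uv.
  move: (Fdir _ _ uu') (Fdir _ _ vv') => /=.
  rewrite /adj /= /D /U => /andP[_ /negbTE->] /andP[_ /negbTE->].
  by rewrite !andbF.
- pose D (i j : bool) := ~~ i && j.
  have Dasym i j : D i j -> ~~ D j i by case: i j => [] [].
  have UD i j : U i j -> ~~ D i j by case: i j => [] [].
  move: adm; apply: (not_admissible_of_model (Usym := Usym) (Dasym := Dasym) (UD := UD) y0 y1) => [|n c].
    by rewrite !big_bool /pair_weight /U /D /y /= !mulr1n !mulr0n; lra.
  case=> phi [_ Fund Fdir]; have := contains_adj Fund Fdir uv.
  move: (Fdir _ _ uu') (Fdir _ _ vv') => /=.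
  rewrite /adj /= /D /U => /andP[/negbTE-> _] /andP[/negbTE-> _].
  by rewrite !andbF.
Qed.

Section ContractionColoring.
Variables (V : finType) (F : mgraph V).
Hypothesis Fcol : collapsible F.

Definition contract (v : V) : contr_vertex F :=
  if insub v is Some w then inl w else inr (v \in heads F).

(** If the tail [u] were also a head, the adjacent vertices [u] and [v] would both be heads, against
    collapsibility. *)
Lemma contract_dir u v : dir F u v -> contract u = inr false /\ contract v = inr true.
Proof.
move=> uv.
have ut : u \in tails F by rewrite finset.in_set; apply/existsP; exists v.
have vh : v \in heads F by rewrite finset.in_set; apply/existsP; exists u.
have uh : u \notin heads F.
  by apply/negP => uh; have := Fcol.1 u v uh vh; rewrite /adj uv orbT.
rewrite /contract !insubF ?finset.in_setU ?vh ?ut ?orbT //.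
by rewrite (negbTE uh).
Qed.

Lemma contract_und u v : und F u v -> adj (F_rhd F) (contract u) (contract v).
Proof.
move=> uv; have uvadj : adj F u v by rewrite /adj uv.
have vuadj : adj F v u by rewrite /adj und_sym uv.
have inr_in x : x \in heads F :|: tails F ->
    x \in if x \in heads F then heads F else tails F.
  by rewrite finset.in_setU; case: ifP.
rewrite /contract; case: insubP => [u' _ Eu|/negPn Hu];
  case: insubP => [v' _ Ev|/negPn Hv].
- by rewrite /adj /= Eu Ev uv.
- apply/orP; left; rewrite /= Eu; apply/existsP; by exists v; rewrite inr_in.
- apply/orP; left; rewrite /= Ev; apply/existsP; by exists u; rewrite inr_in.
(* Both ends are contracted: collapsibility excludes two heads or two tails, and otherwise the edge
   [t -> h] joins the images. *)
move: (inr_in _ Hu) (inr_in _ Hv); rewrite /adj /=.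
case: (u \in heads F); case: (v \in heads F) => //= uX vX.
- by have := Fcol.1 u v uX vX; rewrite uvadj.
- by have := Fcol.2 u v uX vX; rewrite uvadj.
Qed.

Lemma contract_adj u v : adj F u v -> adj (F_rhd F) (contract u) (contract v).
Proof.
case/or3P => [/contract_und//|/contract_dir[-> ->]//|/contract_dir[-> ->]//].
Qed.

End ContractionColoring.

(** The inclusion is followed by two transpositions: one brings [t] to [i], the next brings the
    image of [h] to [j] and fixes [i], which differs from both. *)
Lemma exists_inj_two (k r : nat) (t h : 'I_k) (i j : 'I_r) :
  (k <= r)%N -> t != h -> i != j ->
  exists s : 'I_k -> 'I_r, [/\ injective s, s t = i & s h = j].
Proof.
move=> kr th ij; pose w := widen_ord kr.
have winj : injective w by move=> x y [/val_inj].
have b : tperm (w t) i (w h) != i.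
  rewrite -[X in _ != X](tpermL (w t) i) (inj_eq perm_inj) (inj_eq winj).
  by rewrite eq_sym.
exists (fun x => tperm (tperm (w t) i (w h)) j (tperm (w t) i (w x))); split.
- by move=> x y /perm_inj/perm_inj/winj.
- by rewrite tpermL tpermD // eq_sym.
- by rewrite tpermL.
Qed.

(** Otherwise the colours of an optimal colouring of [F_rhd F] embed into the indices of [B], with
    those of [t] and [h] at a pair with [mD B i j = 2]. Composing with [contract] places [F] in a
    blow-up: distinct indices are adjacent, and every directed edge lands on [(i, j)]. *)
Lemma msize_ub (R : realType) (V : finType) (F : mgraph V) (B : mixed_adj R) :
  collapsible F -> (exists u v, dir F u v) ->
  (forall t, (0 < t)%N -> ~ contains F (blowup (fun _ : 'I_(msize B) => t))) ->
  mD B <> 0 ->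
  (forall i j, i != j -> 0 < mU B i j + mU B j i + mD B i j + mD B j i) ->
  (msize B <= chi (F_rhd F) - 1)%N.
Proof.
move=> Fcol [u0 [v0 uv0]] Bfree D0 Bc; rewrite leqNgt; apply/negP => Hlt.
have [i [j Dij]] : exists i j, mD B i j = 2.
  apply: contrapT => H; apply: D0; apply/matrixP => i j; rewrite mxE.
  by case: (mD_02 i j) => // E; case: H; exists i, j.
have ij : i != j.
  apply/eqP => E; move: Dij; rewrite E => Djj.
  have : mD B j j <> 0 by rewrite Djj; apply/eqP; rewrite pnatr_eq0.
  by move=> H; apply: (H); exact: mD_asym.
have [k [kcol kr]] : exists k, colorable (F_rhd F) k /\ (k <= msize B)%N.
  (* The subtraction is truncated, whence the case split on [chi]. *)
  exists (chi (F_rhd F)); split; last by move: Hlt; rewrite subn1; case: (chi _).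
  by rewrite /chi; case: ex_minnP.
case/existsP: kcol => col /forallP Hcol.
have colP x y : adj (F_rhd F) x y -> col x != col y.
  by move=> xy; have /forallP/(_ y)/implyP := Hcol x; apply.
have [s [sinj st sh]] := exists_inj_two kr
  (colP (inr false) (inr true) isT) ij.
pose t := #|V|.
have t0 : (0 < t)%N by apply/card_gt0P; exists u0.
apply: (Bfree t t0).
pose f v := s (col (contract F v)).
have f_adj u v : adj F u v -> f u != f v.
  by move=> uv; rewrite (inj_eq sinj); apply/colP/(contract_adj Fcol).
pose g v : blow_vertex (A := B) (fun=> t) := @Tagged _ (f v) (fun _ => 'I_t) (enum_rank v).
exists g; split.
- move=> u v E; apply: enum_rank_inj.
  by have := congr1 (fun p : blow_vertex (A := B) (fun=> t) => (tagged p : 'I_t)) E.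
- move=> u v uv; have fuv : f u != f v by apply: f_adj; rewrite /adj uv.
  have guv : g u != g v by apply: contra_neq fuv => E; exact: (congr1 tag E).
  rewrite /adj /= /blow_und /blow_dir guv /=.
  have := Bc _ _ fuv; rewrite -[in mU B (f v) (f u)](mU_sym B) mxE.
  case: (mU_01 (f u) (f v)) => ->; last by rewrite eqxx.
  case: (mD_02 (f u) (f v)) => ->; last by rewrite eqxx orbT.
  case: (mD_02 (f v) (f u)) => ->; last by rewrite eqxx !orbT.
  by rewrite !addr0 ltxx.
move=> u v /(contract_dir Fcol)[Eu Ev].
by rewrite /= /blow_dir /= /f Eu Ev st sh Dij.
Qed.

(** * Quadratic forms on the simplex *)

Section QuadraticForms.
Variables (R : realType) (r : nat).
Implicit Types (M N : 'M[R]_r) (y : 'cV[R]_r).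

Lemma qformDZ M N (rho : R) y : qform (M + rho *: N) y = qform M y + rho * qform N y.
Proof.
rewrite !qformE mulr_sumr -big_split /=; apply: eq_bigr => i _.
rewrite mulr_sumr -big_split /=; apply: eq_bigr => j _.
by rewrite !mxE mulrDr mulrCA.
Qed.

Lemma simplex_sum y : simplex y -> \sum_i y i 0 = 1.
Proof. by case=> y0 <-; apply: eq_bigr => i _; rewrite ger0_norm. Qed.

Lemma simplexI y : (forall i, 0 <= y i 0) -> \sum_i y i 0 = 1 -> simplex y.
Proof.
by move=> y0 y1; split=> //; rewrite -y1; apply: eq_bigr => i _; rewrite ger0_norm.
Qed.

Lemma qform_le y M N : simplex y -> (forall i j, M i j <= N i j) -> qform M y <= qform N y.
Proof.
move=> [y0 _] MN; rewrite !qformE; apply: ler_sum => i _; apply: ler_sum => j _.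
by rewrite ler_wpM2l ?mulr_ge0.
Qed.

Lemma qform_const y (a : R) : simplex y -> qform (const_mx a) y = a.
Proof.
move=> /simplex_sum y1; rewrite qformE.
transitivity (\sum_i y i 0 * a).
  apply: eq_bigr => i _; rewrite (eq_bigr (fun j => y j 0 * (y i 0 * a))).
    by rewrite -mulr_suml y1 mul1r.
  by move=> j _; rewrite mxE; lra.
by rewrite -mulr_suml y1 mul1r.
Qed.

Lemma simplex_qform_max M : simplex (R := R) (r := r) !=set0 ->
  exists2 z, simplex z & forall y, simplex y -> qform M y <= qform M z.
Proof.
move=> [x0 x0s].
(* The transposed simplex is cut out of the unit cube by a closed condition, hence compact. *)
pose A := [set v : 'rV[R]_r | forall i, `[0, 1]%classic (v ord0 i)] `&`
          [set v : 'rV[R]_r | \sum_i v ord0 i = 1].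
have trA v : A v -> simplex v^T.
  case=> v01 v1; apply: simplexI => [i|]; rewrite ?mxE.
    by have := v01 i; rewrite /= in_itv /= => /andP[].
  by rewrite -v1; apply: eq_bigr => i _; rewrite mxE.
have Atr y : simplex y -> A y^T.
  move=> ys; have y1 := simplex_sum ys; case: ys => y0 _; split=> [i|] /=; last first.
    by rewrite -y1; apply: eq_bigr => i _; rewrite mxE.
  rewrite mxE in_itv /= y0 /= -y1 (bigD1 i) //= lerDl.
  exact: sumr_ge0.
have coord i : continuous (fun v : 'rV[R]_r => v ord0 i) by exact: coord_continuous.
have cij i j : continuous (fun v : 'rV[R]_r => v ord0 i * v ord0 j).
  by move=> v; apply: continuousM; exact: coord.
have csum (f : 'I_r -> 'rV[R]_r -> R) :
    (forall i, continuous (f i)) -> continuous (fun v => \sum_i f i v).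
  move=> cf; apply: continuous_big => [|i _]; [exact: add_continuous|exact: cf].
have cA : compact A.
  apply: compact_closedI; first by apply: (@rV_compact R r (fun=> `[0, 1]%classic)) => i; exact: segment_compact.
  have -> : [set v : 'rV[R]_r | \sum_i v ord0 i = 1] =
    (fun v : 'rV[R]_r => \sum_i v ord0 i) @^-1` [set 1] by [].
  apply: preimage_closed => [v _|]; last exact: closed_eq.
  exact: csum.
have cf : continuous (fun v : 'rV[R]_r => qform M v^T).
  have -> : (fun v : 'rV[R]_r => qform M v^T) =
      fun v => \sum_i \sum_j v ord0 i * v ord0 j * M i j.
    apply/funext => v; rewrite qformE; apply: eq_bigr => i _.
    by apply: eq_bigr => j _; rewrite !mxE.
  apply: (csum (fun i v => \sum_j v ord0 i * v ord0 j * M i j)) => i.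
  apply: (csum (fun j v => v ord0 i * v ord0 j * M i j)) => j v.
  apply: (continuousM (cij i j v)); exact: cst_continuous.
have A0 : A !=set0 by exists x0^T; exact: Atr.
have [z Az Hz] := compact_EVT_max A0 cA (continuous_subspaceT cf).
exists z^T; first exact/trA/set_mem.
move=> y /Atr yA; have := Hz y^T; rewrite trmxK; apply; exact/mem_set.
Qed.

End QuadraticForms.

(** The defining conditions of [MF] other than [F]-freeness and the size bound. *)
Definition simple_complete (R : realType) (B : mixed_adj R) : Prop :=
  [/\ forall i, mU B i i = 0, mD B <> 0 &
      forall i j, i != j -> 0 < mU B i j + mU B j i + mD B i j + mD B j i].

Section Optimum.
Variables (R : realType) (B : mixed_adj R).
Hypothesis (U0 : forall i, mU B i i = 0).
Implicit Types y : 'cV[R]_(msize B).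

Lemma qform_mD_ge0 y : simplex y -> 0 <= qform (mD B) y.
Proof.
move=> ys; rewrite -(@qform_const R _ y 0 ys); apply: qform_le => // i j.
by rewrite mxE; case: (mD_02 i j) => ->.
Qed.

Lemma qform_mD_le2 y : simplex y -> qform (mD B) y <= 2.
Proof.
move=> ys; rewrite -[leRHS](@qform_const R _ y 2 ys); apply: qform_le => // i j.
by rewrite mxE; case: (mD_02 i j) => ->.
Qed.

(** The constant 1 is the form of the all-ones matrix, which dominates [mU B] entrywise and strictly
    on the diagonal; a positive coordinate of [y] makes the gap strict. *)
Lemma qform_mU_lt1 y : simplex y -> qform (mU B) y < 1.
Proof.
move=> ys; have y1 := simplex_sum ys; have y0 := ys.1.
have [i _ yi] : exists2 i, true & 0 < y i 0.
  have [i /andP[_ yi]] : exists i, true && (0 < y i 0).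
    by apply: (@psumr_neq0P _ _ xpredT) => //; rewrite y1; exact/eqP/oner_neq0.
  by exists i.
have -> : 1 = qform (mU B) y + \sum_i \sum_j y i 0 * y j 0 * (1 - mU B i j).
  rewrite -[LHS](@qform_const R _ y 1 ys) !qformE -big_split; apply: eq_bigr => k _.
  by rewrite -big_split; apply: eq_bigr => j _; rewrite mxE /=; lra.
have term k j : 0 <= y k 0 * y j 0 * (1 - mU B k j).
  by rewrite !mulr_ge0 //; case: (mU_01 k j) => ->; rewrite ?subrr ?subr0.
rewrite ltrDl (bigD1 i) //= (bigD1 i) //= U0 subr0 mulr1.
apply: ltr_wpDr; first by apply: sumr_ge0 => k _; exact: sumr_ge0.
by apply: ltr_wpDr; [exact: sumr_ge0|exact: mulr_gt0].
Qed.

Lemma theta_ratio_ge (r : R) y : simplex y ->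
  (r%:E <= theta_ratio y)%E = (qform (mD B) y == 0) || (qform (mU B + r *: mD B) y <= 1).
Proof.
move=> ys; rewrite /theta_ratio; case: eqP => [_|/eqP D0]; first by rewrite leey.
have Dpos : 0 < qform (mD B) y by rewrite lt_def D0 qform_mD_ge0.
by rewrite lee_fin ler_pdivlMr // qformDZ lerBrDl.
Qed.

Hypothesis D0 : mD B <> 0.

Lemma exists_qform_mD_gt0 : exists2 y, simplex y & 0 < qform (mD B) y.
Proof.
have [i [j Dij]] : exists i j, mD B i j = 2.
  apply: contrapT => H; apply: D0; apply/matrixP => i j; rewrite mxE.
  by case: (mD_02 i j) => // E; case: H; exists i, j.
have r0 : 0 < (msize B)%:R :> R by rewrite ltr0n (leq_ltn_trans _ (ltn_ord i)).
exists (const_mx (msize B)%:R^-1).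
  apply: simplexI => [k|]; first by rewrite mxE invr_ge0 ltW.
  under eq_bigr do rewrite mxE.
  by rewrite sumr_const card_ord -[LHS]mulr_natl mulfV // gt_eqF.
rewrite qformE; under eq_bigr do under eq_bigr do rewrite !mxE.
have c0 : 0 < (msize B)%:R^-1 :> R by rewrite invr_gt0.
have term k l : 0 <= (msize B)%:R^-1 * (msize B)%:R^-1 * mD B k l.
  by rewrite !mulr_ge0 ?(ltW c0) //; case: (mD_02 k l) => ->.
rewrite (bigD1 i) //= (bigD1 j) //= Dij.
apply: ltr_wpDr; first by apply: sumr_ge0 => k _; exact: sumr_ge0.
by apply: ltr_wpDr; [exact: sumr_ge0|rewrite !mulr_gt0].
Qed.

(** Compactness is applied to the form at the infimum [r], not to the ratio, which is infinite where
    its denominator vanishes. The maximum is at most 1; were it smaller, [r] could be raised. At a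
    maximiser the denominator is positive, because the undirected part is below 1. *)
Lemma ratio_min_attained : exists r : R, ratio_min B = r%:E /\
  exists2 z, simplex z & [/\ theta_ratio z = r%:E,
    qform (mU B + r *: mD B) z = 1 &
    forall y, simplex y -> qform (mU B + r *: mD B) y <= 1].
Proof.
have [y0 y0s Dy0] := exists_qform_mD_gt0.
have inf_ge0 : (0 <= ratio_min B)%E.
  apply: le_ereal_inf_tmp => _ [y ys <-]; rewrite (theta_ratio_ge 0 ys).
  by rewrite scale0r addr0 (ltW (qform_mU_lt1 ys)) orbT.
have inf_lt : (ratio_min B < +oo)%E.
  apply: (@le_lt_trans _ _ (theta_ratio y0)); first by apply: ereal_inf_lbound; exists y0.
  by rewrite /theta_ratio gt_eqF // ltry.
have [r Er] : exists r : R, ratio_min B = r%:E.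
  by exists (fine (ratio_min B)); rewrite fineK // ge0_fin_numE.
exists r; split => //.
have le1 y : simplex y -> qform (mU B + r *: mD B) y <= 1.
  move=> ys; have : (r%:E <= theta_ratio y)%E.
    by rewrite -Er; apply: ereal_inf_lbound; exists y.
  rewrite theta_ratio_ge // => /orP[/eqP Dy|//].
  by rewrite qformDZ Dy mulr0 addr0 ltW // qform_mU_lt1.
have [z zs zmax] := simplex_qform_max (mU B + r *: mD B) (ex_intro _ y0 y0s).
have z1 : qform (mU B + r *: mD B) z = 1.
  apply/eqP; rewrite eq_le le1 //= leNgt; apply/negP => zlt1.
  set M := qform _ z in zlt1.
  (* Raising [r] by [(1 - M) / 2] adds at most [1 - M] to the form, as [qform (mD B) y <= 2]. *)
  suff : ((r + (1 - M) / 2)%:E <= r%:E)%E by rewrite lee_fin; lra.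
  rewrite -Er; apply: le_ereal_inf_tmp => _ [y ys <-].
  rewrite theta_ratio_ge // qformDZ; apply/orP; right.
  have := zmax _ ys; rewrite -/M qformDZ => H.
  have D2 := qform_mD_le2 ys; have Dge := qform_mD_ge0 ys.
  set q := qform (mD B) y in H D2 Dge *; nra.
exists z => //; split => //.
have Dz : 0 < qform (mD B) z.
  rewrite lt_def qform_mD_ge0 // andbT; apply/eqP => Dz.
  by move: z1 (qform_mU_lt1 zs); rewrite qformDZ Dz mulr0 addr0 => ->; rewrite ltxx.
rewrite /theta_ratio gt_eqF //; congr (_%:E); apply/eqP.
by rewrite -z1 qformDZ addrAC subrr add0r mulfK // gt_eqF.
Qed.

Lemma ratio_min_le (r : R) y : simplex y -> 1 <= qform (mU B + r *: mD B) y ->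
  (ratio_min B <= r%:E)%E.
Proof.
move=> ys q1; apply: (@le_trans _ _ (theta_ratio y)).
  by apply: ereal_inf_lbound; exists y.
have := qform_mU_lt1 ys; move: q1; rewrite qformDZ => q1 qU.
have Dge := qform_mD_ge0 ys.
have Dy : 0 < qform (mD B) y.
  rewrite lt_def Dge andbT; apply/eqP => Dz.
  by move: q1; rewrite Dz mulr0 addr0 leNgt qU.
by rewrite /theta_ratio gt_eqF // lee_fin ler_pdivrMr // lerBlDl.
Qed.

Lemma g_eq1 (r : R) z : simplex z -> qform (mU B + r *: mD B) z = 1 ->
  (forall y, simplex y -> qform (mU B + r *: mD B) y <= 1) -> g r B = 1.
Proof.
move=> zs z1 le1; apply/eqP; rewrite eq_le; apply/andP; split.
  by apply: ge_sup; [exists 1; exists z|move=> _ [y ys <-]; exact: le1].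
by apply: ub_le_sup; [exists 1 => _ [y ys <-]; exact: le1|exists z].
Qed.

End Optimum.

(** Uniform weights on the pattern [H] give the value [weight rho H / m ^ 2 > 1]. Symmetrization
    keeps it above 1 and leaves a support of pairwise adjacent vertices, to which [H] is
    restricted. *)
Lemma mixed_of_not_admissible (R : realType) (V : finType) (F : mgraph V) (rho : R) :
  0 <= rho -> ~ admissible F rho ->
  exists (B : mixed_adj R) (y : 'cV[R]_(msize B)),
    [/\ simplex y, 1 < qform (mU B + rho *: mD B) y,
     (forall t, (0 < t)%N -> ~ contains F (blowup (fun _ : 'I_(msize B) => t))) &
     simple_complete B].
Proof.
move=> rho0 /(pattern_of_not_admissible rho0)[m [H [Fhom Hw]]].
have m0 : 0 < m%:R :> R.
  rewrite ltr0n lt0n; apply/eqP => E; subst m.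
  by move: Hw; rewrite /weight big_ord0 expr0n ltxx.
pose W := pair_weight rho (und H) (dir H).
have W0 i : W i i = 0.
  rewrite /W /pair_weight und_irr (_ : dir H i i = false) ?mulr0 ?addr0 //.
  by apply/negP => Hi; have := dir_asym Hi; rewrite Hi.
pose y (i : 'I_m) : R := m%:R^-1.
have y0 i : 0 <= y i by rewrite invr_ge0 ltW.
have y1 : \sum_i y i = 1.
  by rewrite sumr_const card_ord -[LHS]mulr_natl mulfV // gt_eqF.
have [z [z0 z1 yz zW]] := symmetrize W0 y0 y1.
have {}yz : 1 < \sum_i \sum_j z i * z j * W i j.
  apply: lt_le_trans yz.
  have -> : \sum_i \sum_j y i * y j * W i j = weight rho H / m%:R ^+ 2.
    rewrite mulr_suml; apply: eq_bigr => i _; rewrite mulr_suml.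
    by apply: eq_bigr => j _; rewrite /y -invfM -expr2 mulrC.
  by rewrite ltr_pdivlMr ?exprn_gt0 // mul1r.
pose S := [set i | z i != 0]%SET.
pose e (i : 'I_#|S|) : 'I_m := enum_val i.
have big_e (f : 'I_m -> R) : (forall i, z i = 0 -> f i = 0) ->
    \sum_i f (e i) = \sum_i f i.
  move=> f0; rewrite /e -big_enum_val big_mkcond; apply: eq_bigr => i _.
  by rewrite finset.in_set; case: eqP => //= /f0.
have ze i : z (e i) != 0 by have := enum_valP i; rewrite finset.in_set.
pose v : 'cV[R]_#|S| := \col_i z (e i).
have vs : simplex v.
  apply: simplexI => [i|]; first by rewrite mxE.
  by under eq_bigr do rewrite mxE; rewrite big_e.
have qv : 1 < qform (mU (mixed_of R H e) + rho *: mD (mixed_of R H e)) v.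
  rewrite qformE (_ : \sum_i _ = \sum_i \sum_j z i * z j * W i j) //.
  rewrite -big_e; last by move=> i zi; apply: big1 => j _; rewrite zi !mul0r.
  apply: eq_bigr => i _.
  rewrite -big_e; last by move=> j zj; rewrite zj mulr0 mul0r.
  apply: eq_bigr => j _; rewrite !mxE; congr (_ * (_ + _)).
  by rewrite -muln2 natrM; lra.
have U0 i : mU (mixed_of R H e) i i = 0 by rewrite mxE und_irr.
exists (mixed_of R H e), v; split => //.
  by move=> t _ /mhom_of_contains_blowup.
split => //.
  (* Without directed edges the form would stay below 1. *)
  move=> D0; move: qv; rewrite D0 scaler0 addr0.
  by rewrite ltNge (ltW (qform_mU_lt1 U0 vs)).
move=> i j ij; have eij : e i != e j by rewrite (inj_eq enum_val_inj).
have := zW _ _ (ze i) (ze j) eij; rewrite /W /pair_weight !mxE.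
case: (und H (e i) (e j)); case: (und H (e j) (e i));
  case: (dir H (e i) (e j)); case: (dir H (e j) (e i));
  by rewrite ?mulr1n ?mulr0n ?mulr0 ?addr0 ?eqxx //= => _; rewrite ?mulr1n ?mulr0n; lra.
Qed.

(** * Passing to the limit in rho *)

(** Any inflation of [B] embeds into a uniform blow-up, so it inherits [F]-freeness and
    [not_admissible_of_model] applies. *)
Lemma not_admissible_of_mixed (R : realType) (V : finType) (F : mgraph V)
    (B : mixed_adj R) (rho : R) (y : 'cV[R]_(msize B)) :
  (forall t, (0 < t)%N -> ~ contains F (blowup (fun _ : 'I_(msize B) => t))) ->
  simplex y -> 1 < qform (mU B + rho *: mD B) y -> ~ admissible F rho.
Proof.
move=> Bfree ys q1.
pose U i j := mU B i j == 1; pose D i j := mD B i j == 2.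
have Usym : symmetric U by move=> i j; rewrite /U -[in LHS](mU_sym B) mxE.
have Dasym i j : D i j -> ~~ D j i.
  rewrite /D => /eqP Dij; rewrite mD_asym ?Dij; first by rewrite eq_sym pnatr_eq0.
  by apply/eqP; rewrite pnatr_eq0.
have UD i j : U i j -> ~~ D i j.
  rewrite /U /D => /eqP Uij; case: (mUD i j) => [|->]; last by rewrite eq_sym pnatr_eq0.
  by rewrite Uij => /eqP; rewrite oner_eq0.
apply: (not_admissible_of_model (Usym := Usym) (Dasym := Dasym) (UD := UD) ys.1
  (simplex_sum ys)).
  apply: lt_le_trans q1 _; rewrite qformE; apply: ler_sum => i _.
  apply: ler_sum => j _; rewrite !mxE le_eqVlt; apply/orP; left; apply/eqP.
  congr (_ * _); rewrite /pair_weight /U /D.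
  by case: (mU_01 i j) => ->; case: (mD_02 i j) => ->;
    rewrite ?eqxx ?[0 == 1]eq_sym ?[0 == 2]eq_sym ?oner_eq0 ?pnatr_eq0 /= ?mulr1n ?mulr0n; lra.
(* Class size [n.+1] is positive even for [n = 0]. *)
move=> n c [phi [phi_inj Fund Fdir]]; apply: (Bfree n.+1) => //.
pose h (u : 'I_n) : blow_vertex (A := B) (fun=> n.+1) :=
  @Tagged _ (c u) (fun _ => 'I_n.+1) (widen_ord (leqnSn n) u).
have h_inj : injective h.
  move=> u v E; have /= := congr1 (fun p : blow_vertex (A := B) (fun=> n.+1) =>
    val (tagged p : 'I_n.+1)) E.
  exact: val_inj.
exists (h \o phi); split; first exact: inj_comp.
  move=> u v /Fund; rewrite /adj /= /blow_und /blow_dir /= (inj_eq h_inj).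
  by [].
by move=> u v /Fdir.
Qed.

Lemma mixed_adj_eq (R : realType) (B C : mixed_adj R) (e : msize B = msize C) :
  (forall i j, mU B i j = mU C (cast_ord e i) (cast_ord e j)) ->
  (forall i j, mD B i j = mD C (cast_ord e i) (cast_ord e j)) -> B = C.
Proof.
case: B C e => [r U D p1 p2 p3 p4 p5] [r' U' D' q1 q2 q3 q4 q5] /= e.
destruct e => HU HD.
have E1 : U = U' by apply/matrixP => i j; rewrite HU !cast_ord_id.
have E2 : D = D' by apply/matrixP => i j; rewrite HD !cast_ord_id.
subst U' D'.
by rewrite (Prop_irrelevance p1 q1) (Prop_irrelevance p2 q2)
  (Prop_irrelevance p3 q3) (Prop_irrelevance p4 q4) (Prop_irrelevance p5 q5).
Qed.

(** A finite code for matrices of size at most [k]: tables padded with [false], the recorded size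
    telling padding from zero entries. *)
Definition mixed_code (R : realType) (k : nat) (B : mixed_adj R) :
    'I_k.+1 * {ffun 'I_k.+1 * 'I_k.+1 -> bool * bool} :=
  (inord (msize B),
   [ffun p => if (insub (val p.1), insub (val p.2)) is (Some i, Some j)
              then (mU B i j == 1, mD B i j == 2) else (false, false)]).

Lemma mixed_code_inj (R : realType) (k : nat) (B C : mixed_adj R) :
  (msize B <= k)%N -> (msize C <= k)%N -> mixed_code k B = mixed_code k C -> B = C.
Proof.
move=> Bk Ck [/(congr1 val) /= E /ffunP Ecode].
have e : msize B = msize C by move: E; rewrite !inordK // ltnS.
have entry i j : (mU B i j == 1, mD B i j == 2) =
    (mU C (cast_ord e i) (cast_ord e j) == 1, mD C (cast_ord e i) (cast_ord e j) == 2).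
  have lt (l : 'I_(msize B)) : (l < k.+1)%N by rewrite ltnS (leq_trans _ Bk) // ltnW.
  have := Ecode (inord i, inord j); rewrite !ffunE /= !inordK //.
  rewrite (valK i) (valK j).
  by rewrite -[val i in RHS]/(val (cast_ord e i)) -[val j in RHS]/(val (cast_ord e j)) !valK.
have ne01 : (0 == 1 :> R) = false by rewrite eq_sym oner_eq0.
have ne02 : (0 == 2 :> R) = false by rewrite eq_sym pnatr_eq0.
apply: (mixed_adj_eq (e := e)) => i j; case: (entry i j) => EU ED.
  by move: EU; case: (mU_01 i j) => ->; case: (mU_01 (cast_ord e i) (cast_ord e j)) => ->;
    rewrite ?eqxx ?ne01.
by move: ED; case: (mD_02 i j) => ->; case: (mD_02 (cast_ord e i) (cast_ord e j)) => ->;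
  rewrite ?eqxx ?ne02.
Qed.

(** Finitely many matrices have size at most [k]. If all ratios exceeded [th], each code would get a
    threshold above [th] and below the ratio; the least threshold contradicts the hypothesis. *)
Lemma exists_ratio_min_le (R : realType) (k : nat) (S : set (mixed_adj R)) (th : R) :
  (forall B, S B -> (msize B <= k)%N) ->
  (forall rho, th < rho -> exists2 B, S B & (ratio_min B <= rho%:E)%E) ->
  exists2 B, S B & (ratio_min B <= th%:E)%E.
Proof.
move=> Sk H; apply: contrapT => /forall2NP no.
have [T HT] : {T : 'I_k.+1 * {ffun 'I_k.+1 * 'I_k.+1 -> bool * bool} -> R &
    forall c, th < T c /\ forall B, S B -> mixed_code k B = c -> ((T c)%:E < ratio_min B)%E}.
  apply: (@choice _ _ (fun c t => th < t /\
     forall B, S B -> mixed_code k B = c -> (t%:E < ratio_min B)%E)) => c.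
  have [[B SB Bc]|nB] := EM (exists2 B, S B & mixed_code k B = c); last first.
    by exists (th + 1); split; [lra|move=> B SB Bc; case: nB; exists B].
  have thB : (th%:E < ratio_min B)%E.
    by case: (no B) => // /negP; rewrite -ltNge.
  have [t [tht tB]] : exists t, th < t /\ (t%:E < ratio_min B)%E.
    move: thB; case: (ratio_min B) => [s| |] //=.
      by rewrite lte_fin => ths; exists ((th + s) / 2); rewrite lte_fin; split; lra.
    by move=> _; exists (th + 1); split; [lra|exact: ltry].
  exists t; split => // C SC Cc.
  by rewrite (mixed_code_inj (Sk _ SC) (Sk _ SB) (etrans Cc (esym Bc))).
pose rho := \big[Num.min/(th + 1)]_c T c.
have rho_gt : th < rho.
  by rewrite /rho; elim/big_ind: _ => [|x y|c _]; [lra|rewrite lt_min => -> ->|case: (HT c)].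
have [B SB Brho] := H _ rho_gt.
have [_ /(_ B SB erefl)] := HT (mixed_code k B).
apply/negP; rewrite -leNgt (le_trans Brho) // lee_fin /rho.
exact: bigmin_le_cond.
Qed.

(** * The minimum formula for [theta] *)

Theorem theorem4p13 (R : realType) (V : finType) (F : mgraph V) :
  (exists u v : V, dir F u v) ->
  (1 < theta R F < +oo)%E ->
  [/\ (forall B : mixed_adj R, (MF R F `\ K) B ->
         is_min (ratios B) (ratio_min B)),
      is_min [set ratio_min B | B in MF R F `\ K] (theta R F) &
      forall B : mixed_adj R, (MF R F `\ K) B ->
        ratio_min B = theta R F -> g (fine (theta R F)) B = 1].
Proof.
move=> Fdir; rewrite /theta; case: asboolP => [_ /andP[_]|_]; first by rewrite ltxx.
set th := xget 0 _; rewrite lte_fin => /andP[th1 _].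
(* Without a maximum [xget] would return its default 0, contrary to [1 < th]. *)
have [th_adm th_max] : is_max (admissible F) th.
  apply: xgetPex; apply: contrapT => /forallNP H.
  by move: th1; rewrite /th xgetPN // ltr10.
have Fcol := collapsible_of_admissible th1 th_adm.
have MFP B : (MF R F `\ K) B -> simple_complete B /\
    forall t, (0 < t)%N -> ~ contains F (blowup (fun _ : 'I_(msize B) => t)).
  by case=> -[BK|[Bf _ U0 D0 Bc]] nK; [case: (nK BK)|split; first split].
(* A ratio below [th] would make the form at [th] exceed 1, so [th] would not be admissible. *)
have th_le B : (MF R F `\ K) B -> (th%:E <= ratio_min B)%E.
  move=> /MFP[[U0 D0 _] Bf]; apply: le_ereal_inf_tmp => _ [y ys <-].
  rewrite theta_ratio_ge //; apply/orP; right; rewrite leNgt; apply/negP => q1.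
  exact: (not_admissible_of_mixed Bf ys q1 th_adm).
have [B0 B0MF B0th] : exists2 B, (MF R F `\ K) B & (ratio_min B <= th%:E)%E.
  apply: (@exists_ratio_min_le _ (chi (F_rhd F) - 1)).
    by move=> B [[->|[]] // nK]; case: nK.
  (* By maximality of [th], a larger [rho] is not admissible and therefore yields a matrix of ratio
     at most [rho]. *)
  move=> rho th_rho.
  have rho_adm : ~ admissible F rho by move=> /th_max; rewrite leNgt th_rho.
  have rho0 : 0 <= rho by lra.
  have [B [y [ys q1 Bf [U0 D0 Bc]]]] := mixed_of_not_admissible rho0 rho_adm.
  exists B; last exact: (ratio_min_le U0 ys (ltW q1)).
  split; last by move=> BK; case: D0; rewrite BK.
  by right; split => //; exact: msize_ub.
split.
- move=> B /MFP[[U0 D0 _] _].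
  have [r [Er [z zs [zr _ _]]]] := ratio_min_attained U0 D0.
  split; last exact: ereal_inf_lbound.
  by rewrite Er; exists z.
- split; last by move=> _ [B BMF <-]; exact: th_le.
  by exists B0 => //; apply/eqP; rewrite eq_le B0th th_le.
move=> B /MFP[[U0 D0 _] _].
have [r [-> [z zs [_ z1 le1]]]] := ratio_min_attained U0 D0.
by move=> [<-]; exact: g_eq1 zs z1 le1.
Qed.
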